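(* Let $K = \mathbb{Q}(\zeta_{2^n})$ with $n \geq 1$. Suppose $f \in K[t^{\pm 1}]$ factors as $u\,p_1^{e_1}p_2^{e_2}\cdots p_k^{e_k}$ where $u$ is a unit of $K[t^{\pm1}]$ and the $p_i$ are pairwise non-associate irreducibles of $K[t^{\pm 1}]$ (with $e_i\ge 1$). Then $f$ is a norm in $\mathbb{Q}(\zeta_{2^\infty})[t^{\pm 1}]$ if and only if for every $i$ one of the following holds: (1) $\overline{p_i}$ is an associate of $p_i$ and $e_i$ is even; or (2) $\overline{p_i}$ is an associate of $p_i$ with $e_i$ odd, and $p_i$ is a norm in $\mathbb{Q}(\zeta_{2^\ell})[t^{\pm 1}]$ with $\ell = n + d(p_i) + 1$; or (3) $\overline{p_i}$ is an associate of some other $p_j$ (with $j\ne i$) and $e_i = e_j$.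
   Context: $\zeta_{N} = e^{2\pi i/N}$ and $\mathbb{Q}(\zeta_{2^\infty}) = \bigcup_k \mathbb{Q}(\zeta_{2^k}) \subset \mathbb{C}$. For a subfield $F\subset\mathbb{C}$ closed under complex conjugation and $g = \sum a_j t^j \in F[t^{\pm1}]$, put $\overline{g} = \sum \overline{a_j}\,t^{-j}$; an element $f \in F[t^{\pm 1}]$ is a norm in $F[t^{\pm1}]$ when $f = u\,g\,\overline{g}$ for some $g \in F[t^{\pm 1}]$ and some unit $u$ of $F[t^{\pm1}]$. Associates are taken in $K[t^{\pm1}]$. For a finite group $G$, $d(G)$ is the maximum of the integers $k \geq 0$ such that $G$ has a normal subgroup $H$ with quotient $G/H$ isomorphic to $\mathbb{Z}/2^k\mathbb{Z}$ or (for $k \ge 1$) to $\mathbb{Z}/2\mathbb{Z}\oplus\mathbb{Z}/2^{k-1}\mathbb{Z}$. For $p \in K[t^{\pm 1}]$ irreducible, $d(p) = d(\mathrm{Gal}(L_p/K))$ where $L_p \subset \mathbb{C}$ is the splitting field of $p$ over $K$. *)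

(* Defs.v *)
From HB Require Import structures.
From mathcomp Require Import all_boot all_order all_algebra all_fingroup.
From mathcomp Require Import all_solvable all_field.
From mathcomp Require Import finmap monalg zify.

Set Implicit Arguments.
Unset Strict Implicit.
Unset Printing Implicit Defensive.

Import Order.TTheory GRing.Theory Num.Theory.
Local Open Scope ring_scope.

(* The Laurent polynomial ring R[t, t^-1]: finitely supported functions       *)
(* int -> R with the convolution product; g@_j is the coefficient of t^j and  *)
(* << a *g j >> is the monomial a t^j.  monalg only makes {malg R[K]} a ring  *)
(* when the monoid K has no nontrivial unit, which excludes K = int; hence    *)
(* the alias carrying its own ring structure.                                 *)
Definition laurent (R : nzRingType) := {malg R[int]}.

Section LaurentRing.
Context (R : comNzRingType).
Implicit Types g h : laurent R.

HB.instance Definition _ := GRing.Lmodule.on (laurent R).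

Definition lone : laurent R := << 1 *g (0 : int) >>.

Definition lmul g h : laurent R :=
  \sum_(i <- msupp g) \sum_(j <- msupp h) << g@_i * h@_j *g (i + j)%R >>.

Local Open Scope fset_scope.

Lemma lmulw (d1 d2 : {fset int}) g h :
  msupp g `<=` d1 -> msupp h `<=` d2 ->
  lmul g h = \sum_(i <- d1) \sum_(j <- d2) << g@_i * h@_j *g (i + j)%R >>.
Proof.
move=> le1 le2; rewrite /lmul (big_fset_incl _ le1) /=.
  apply/eq_bigr=> i _; apply/big_fset_incl => // j _ /mcoeff_outdom ->.
  by rewrite mulr0 monalgU0.
move=> i _ /mcoeff_outdom gi.
by rewrite big1 // => j _; rewrite gi mul0r monalgU0.
Qed.

Lemma lmulC : commutative lmul.
Proof.
move=> g h; rewrite /lmul exchange_big; apply/eq_bigr=> j _.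
by apply/eq_bigr=> i _; rewrite mulrC addrC.
Qed.

Lemma lmul0l : left_zero 0 lmul.
Proof. by move=> g; rewrite /lmul msupp0 big_seq_fset0. Qed.

Lemma lmulUl c i h :
  lmul << c *g i >> h = \sum_(j <- msupp h) << c * h@_j *g (i + j)%R >>.
Proof.
rewrite (lmulw msuppU_le (fsubset_refl _)) big_seq_fset1.
by apply/eq_bigr => j _; rewrite mcoeffUU.
Qed.

Lemma lmulUU c1 c2 (i j : int) :
  lmul << c1 *g i >> << c2 *g j >> = << c1 * c2 *g (i + j)%R >>.
Proof. by rewrite (lmulw msuppU_le msuppU_le) !big_seq_fset1 !mcoeffUU. Qed.

Lemma lmulDl : left_distributive lmul +%R.
Proof.
move=> g1 g2 g.
rewrite [lmul g1 g](lmulw (fsubsetUl _ (msupp g2)) (fsubset_refl _)).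
rewrite [lmul g2 g](lmulw (fsubsetUr (msupp g1) _) (fsubset_refl _)).
rewrite (lmulw (msuppD_le _ _) (fsubset_refl _)).
rewrite -big_split /=; apply/eq_bigr=> i _.
rewrite -big_split /=; apply/eq_bigr=> j _.
by rewrite mcoeffD mulrDl monalgUD.
Qed.

Lemma lmulDr : right_distributive lmul +%R.
Proof. by move=> g h1 h2; rewrite lmulC lmulDl !(lmulC g). Qed.

Lemma lmul0r : right_zero 0 lmul.
Proof. by move=> g; rewrite lmulC lmul0l. Qed.

Lemma lmulEl g h : lmul g h = \sum_(i <- msupp g) lmul << g@_i *g i >> h.
Proof. by apply/eq_bigr=> i _; rewrite lmulUl. Qed.

Lemma lmulEr g h : lmul g h = \sum_(j <- msupp h) lmul g << h@_j *g j >>.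
Proof. by rewrite lmulC lmulEl; apply/eq_bigr=> j _; rewrite lmulC. Qed.

Lemma lmulA : associative lmul.
Proof.
move=> g1 g2 g3.
rewrite [RHS](big_morph (lmul^~ _) (fun _ _ => lmulDl _ _ _) (lmul0l _)).
rewrite lmulEl; apply/eq_bigr=> i _.
rewrite [LHS](big_morph (lmul _) (fun _ _ => lmulDr _ _ _) (lmul0r _)).
rewrite [RHS](big_morph (lmul^~ _) (fun _ _ => lmulDl _ _ _) (lmul0l _)).
apply/eq_bigr=> j _.
rewrite [LHS](big_morph (lmul _) (fun _ _ => lmulDr _ _ _) (lmul0r _)).
by rewrite lmulEr; apply/eq_bigr=> k _; rewrite !lmulUU mulrA addrA.
Qed.

Lemma lmul1l : left_id lone lmul.
Proof.
move=> g; rewrite lmulUl [RHS]monalgE.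
by apply/eq_bigr=> j _; rewrite mul1r add0r.
Qed.

Lemma lone_neq0 : lone != 0.
Proof. by apply/eqP/malgP=> /(_ (0 : int)) /eqP; rewrite !mcoeffsE oner_eq0. Qed.

HB.instance Definition _ := GRing.Zmodule_isComNzRing.Build (laurent R)
  lmulA lmulC lmul1l lmulDl lone_neq0.

Lemma lscaleAl (a : R) (g h : laurent R) : a *: (g * h) = (a *: g) * h.
Proof.
rewrite -[LHS]/(a *: lmul g h) -[RHS]/(lmul (a *: g) h).
rewrite (lmulw (msuppZ_le a g) (fsubset_refl _)) /lmul scaler_sumr.
apply/eq_bigr=> i _; rewrite scaler_sumr; apply/eq_bigr=> j _.
by apply/malgP=> k; rewrite mcoeffZ !mcoeffU mcoeffZ mulrnAr mulrA.
Qed.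

HB.instance Definition _ :=
  GRing.Lmodule_isLalgebra.Build R (laurent R) lscaleAl.

Lemma laurentUU (a b : R) (i j : int) :
  (<< a *g i >> : laurent R) * (<< b *g j >> : laurent R) =
    << a * b *g (i + j)%R >>.
Proof. exact: lmulUU. Qed.

End LaurentRing.

Section LaurentRoots.
Context (F : fieldType).
Implicit Types g : laurent F.

Definition leval g (x : F) : F := \sum_(j <- msupp g) g@_j * x ^ j.

Definition lshift g : nat := \max_(j <- msupp g) `|j|%N.

(* t^(lshift g) * g, as an ordinary polynomial. *)
Definition lpoly g : {poly F} :=
  \poly_(i < (lshift g).*2.+1) g@_(i%:Z - (lshift g)%:Z).

Lemma lshift_ge g j : j \in msupp g -> (`|j| <= lshift g)%N.
Proof. by move=> jg; apply: (@leq_bigmax_seq _ _ xpredT (fun j : int => `|j|%N)). Qed.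

Lemma horner_lpoly g x : x != 0 -> (lpoly g).[x] = x ^+ lshift g * leval g x.
Proof.
move=> x0; rewrite /lpoly horner_poly /leval mulr_sumr.
set m := lshift g.
pose h (i : 'I_(m.*2.+1)) : int := (i : nat)%:Z - m%:Z.
have h_inj : injective h by move=> i j /addIr[] /val_inj.
rewrite (eq_bigr (fun i => g@_(h i) * x ^ (h i + m%:Z))); last first.
  by move=> i _; rewrite /h subrK.
rewrite -(big_map h xpredT (fun j => g@_j * x ^ (j + m%:Z))).
rewrite (bigID (mem (msupp g))) /= [X in _ + X]big1 ?addr0; last first.
  by move=> j /mcoeff_outdom ->; rewrite mul0r.
rewrite -big_filter (perm_big (msupp g)) /=.
  by apply: eq_bigr => j _; rewrite expfzDr // mulrA mulrC.
apply: uniq_perm; rewrite ?fset_uniq ?filter_uniq ?map_inj_uniq ?index_enum_uniq //.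
move=> j; rewrite mem_filter; apply: andb_idr => jg.
have := lshift_ge jg; rewrite -/m => jm.
have jE : j = (`|(j + m%:Z)%R|%N)%:Z - m%:Z by lia.
have lt : (`|(j + m%:Z)%R|%N < m.*2.+1)%N by lia.
by apply/mapP; exists (Ordinal lt); rewrite ?mem_index_enum.
Qed.

End LaurentRoots.

(* C is modelled by algC, the algebraic complex numbers: every subfield       *)
(* considered here (cyclotomic fields, splitting fields over them) is         *)
(* algebraic over Q.                                                          *)

(* e^(2 pi i / N) for N > 0: by the argument convention of n.-root,           *)
(* N.-root (-1) is e^(pi i / N).                                              *)
Definition zeta (N : nat) : algC := (N.-root (-1)) ^+ 2.

Lemma zeta2_prim k : (2 ^ k)%N.-primitive_root (zeta (2 ^ k)).
Proof.
set w : algC := (2 ^ k)%N.-root (-1).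
have wk : w ^+ (2 ^ k) = -1 by rewrite rootCK // expn_gt0.
have w2 : w ^+ (2 ^ k.+1) = 1 by rewrite expnSr exprM wk expr2 mulrNN mul1r.
have [d prim_d d_dvd] := prim_order_exists (expn_gt0 2 k.+1) w2.
have /(dvdn_pfactor _ _ (isT : prime 2))[m le_m def_d] := d_dvd.
have m_eq : m = k.+1.
  apply/eqP; rewrite eqn_leq le_m ltnNge; apply/negP=> le_mk.
  have : w ^+ (2 ^ k) == 1 by rewrite -(prim_order_dvd prim_d) def_d dvdn_exp2l.
  by rewrite wk eq_sym -subr_eq0 opprK -mulr2n pnatr_eq0.
have := exp_prim_root prim_d 2; rewrite def_d m_eq /zeta -/w.
by rewrite (gcdn_idPl _) ?expnS ?mulKn // dvdn_mulr.
Qed.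

(* The subfield Q(z) of C. *)
Definition Qadj (z : algC) : algC -> Prop := fun x =>
  exists a b : {poly rat},
    x = (map_poly ratr a).[z] / (map_poly ratr b).[z].

Definition Qzeta2 (k : nat) : algC -> Prop := Qadj (zeta (2 ^ k)).

Definition Qzeta2oo : algC -> Prop := fun x => exists k, Qzeta2 k x.

(* For F a subfield of C, F[t, t^-1] is the subring of laurent algC of the    *)
(* Laurent polynomials with coefficients in F.                                *)
Section LaurentOver.
Variable F : algC -> Prop.
Implicit Types f g h u : laurent algC.

Definition laurent_over g : Prop := forall j, F g@_j.

Definition lunit u : Prop :=
  laurent_over u /\ exists2 v, laurent_over v & u * v = 1.

Definition lassociate g h : Prop := exists2 u, lunit u & g = u * h.

Definition lirreducible g : Prop :=
  [/\ laurent_over g, g != 0, ~ lunit g &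
      forall a b, laurent_over a -> laurent_over b -> g = a * b ->
        lunit a \/ lunit b].

Definition lbar g : laurent algC :=
  \sum_(j <- msupp g) << (g@_j)^* *g (- j)%R >>.

Definition lnorm f : Prop :=
  exists u g, [/\ lunit u, laurent_over g & f = u * g * lbar g].

End LaurentOver.

Lemma mcoeff_lbar (g : laurent algC) j : (lbar g)@_j = (g@_(- j))^*.
Proof.
rewrite /lbar raddf_sum /=.
have [jg|/mcoeff_outdom gj] := boolP (- j \in msupp g).
  rewrite (big_fsetD1 (- j)) //= mcoeffU opprK eqxx mulr1n big1_fset ?addr0 //.
  by move=> i; rewrite in_fsetD1 mcoeffU eqr_oppLR => /andP[/negPf->].
rewrite gj rmorph0 big1_fset // => i ig _; rewrite mcoeffU eqr_oppLR.
by case: eqP ig => // ->; rewrite -mcoeff_neq0 gj eqxx.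
Qed.

Definition has_2quotient (gT : finGroupType) (G : {group gT}) (k : nat) : bool :=
  [exists H : {group gT}, (H <| G)%g &&
    ((G / H \isog Zp (2 ^ k))%g
     || (0 < k)%N && (G / H \isog setX (Zp 2) (Zp (2 ^ k.-1)))%g)].

(* The bound k <= #|G| is harmless, see leq_dgroup below.                     *)
Definition dgroup (gT : finGroupType) (G : {group gT}) : nat :=
  \max_(k < #|G|.+1 | has_2quotient G k) k.

Lemma leq_dgroup (gT : finGroupType) (G : {group gT}) k :
  has_2quotient G k -> (k <= dgroup G)%N.
Proof.
move=> hk; suff lt_k : (k < #|G|.+1)%N.
  exact: (@leq_bigmax_cond _ (fun k : 'I_#|G|.+1 => has_2quotient G k)
            (fun k : 'I__ => k : nat) (Ordinal lt_k)).
have [H /andP[nHG oG]] := existsP hk.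
suff oGH : (2 ^ k)%N = #|(G / H)%g|.
  rewrite ltnS (leq_trans (ltnW (ltn_expl k (ltnSn 1)))) // oGH.
  exact: leq_quotient.
have oZp m : #|Zp (2 ^ m)| = (2 ^ m)%N by rewrite card_Zp ?expn_gt0.
case/orP: oG => [/card_isog->|/andP[k0 /card_isog->]]; first by rewrite oZp.
by rewrite cardsX oZp (oZp 1%N) -expnD add1n prednK.
Qed.

Lemma dgroup_attained (gT : finGroupType) (G : {group gT}) :
  has_2quotient G (dgroup G).
Proof.
have h0 : has_2quotient G 0.
  apply/existsP; exists G; rewrite normal_refl /=; apply/orP; left.
  by apply: trivial_isog; first exact: trivg_quotient.
pose A := [pred k : 'I_#|G|.+1 | has_2quotient G k].
have A_gt0 : (0 < #|A|)%N by apply/card_gt0P; exists ord0.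
rewrite /dgroup (eq_bigl (mem A)) //.
by have [k hk ->] := eq_bigmax_cond (fun k : 'I_#|G|.+1 => k : nat) A_gt0.
Qed.

(* A number field M, normal over Q and embedded in C, with elements           *)
(* nf_gens M mapped to s by the embedding.                                    *)
Record normal_field (s : seq algC) := NormalField {
  nf_field :> splittingFieldType rat;
  nf_emb : {rmorphism nf_field -> algC};
  nf_gens : seq nf_field;
  nf_gensE : map nf_emb nf_gens = s
}.

Lemma normal_field_exists (s : seq algC) : normal_field s.
Proof.
have [P nzP sP] : {P : {poly rat} | P != 0
    & all (root (map_poly ratr P : {poly algC})) s}.
  elim: s => [|x s [P nzP sP]]; first by exists 1; rewrite ?oner_eq0.
  have [r [_ mon_r] dv_r] := minCpolyP x.
  exists (r * P); first by rewrite mulf_neq0 // monic_neq0.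
  rewrite /= rmorphM /= rootM dv_r dvdpp /=.
  by apply: sub_all sP => y; rewrite rootM orbC => ->.
have [r Dr] := closed_field_poly_normal (map_poly ratr P : {poly algC}).
have [L [iota [rr Drr genL]]] := num_field_exists r.
have splitL : SplittingField.axiom L.
  exists (map_poly (in_alg L) P); first by apply/polyOver1P; exists P.
  exists rr => //; rewrite -(eqp_map iota) -map_poly_comp.
  rewrite (eq_map_poly (g := ratr)); last first.
    by move=> a; rewrite /= alg_num_field fmorph_rat.
  rewrite Dr -Drr big_map rmorph_prod /=.
  rewrite (eq_bigr (fun z => map_poly iota ('X - z%:P))).
    by rewrite eqp_scale // lead_coef_eq0 map_poly_eq0.
  by move=> z _; rewrite map_polyXsubC.
pose M : splittingFieldType rat :=
  HB.pack L (FieldExt_isSplittingField.Build rat L splitL).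
have /all_sig2[g] : forall x : algC, {y : M | x \in s -> iota y = x & true}.
  move=> x; have [xs|] := boolP (x \in s); last by exists 0.
  have : x \in map iota rr.
    rewrite Drr -root_prod_XsubC -(rootZ _ _ (_ : lead_coef (map_poly ratr P) != 0)).
      by rewrite -Dr (allP sP).
    by rewrite lead_coef_eq0 map_poly_eq0.
  by case/mapP/sig2_eqW => y _ ->; exists y.
move=> gK _; exists M iota (map g s).
by rewrite -map_comp map_id_in // => x /gK.
Qed.

(* The roots in C of a Laurent polynomial; 0 may occur in the list, but it    *)
(* does not affect the field generated.                                       *)
Definition lroots (p : laurent algC) : seq algC :=
  sval (closed_field_poly_normal (lpoly p)).

(* d(p) over the base field K = Q(z).  Inside a normal number field M         *)
(* embedded in C and containing z and the roots of p, K is <<1; z>> and the   *)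
(* splitting field L_p of p over K is K(roots of p).                          *)
Section DPoly.
Variables (z : algC) (p : laurent algC).

Definition dp_model : normal_field (z :: lroots p) := normal_field_exists _.

Definition dp_base : {subfield dp_model} := <<1; head 0 (nf_gens dp_model)>>%AS.

Definition dp_split : {subfield dp_model} :=
  <<dp_base & behead (nf_gens dp_model)>>%AS.

Definition dpoly : nat := dgroup 'Gal(dp_split / dp_base)%G.

Lemma dp_gens : let s := nf_gens dp_model in
  nf_emb dp_model (head 0 s) = z /\ map (nf_emb dp_model) (behead s) = lroots p.
Proof.
by have := nf_gensE dp_model; case: (nf_gens _) => //= x s [-> ->].
Qed.

Lemma dp_baseP c :
  Qadj z c <-> exists2 x, x \in dp_base & nf_emb dp_model x = c.
Proof.
have [zE _] := dp_gens; rewrite /dp_base; set z1 := head _ _ in zE *.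
set iota := nf_emb _ in zE *.
have hornE (a : {poly rat}) :
    iota (map_poly (in_alg dp_model) a).[z1] = (map_poly ratr a).[z].
  rewrite -horner_map /= zE -map_poly_comp; congr _.[z].
  by apply: eq_map_poly => b; rewrite /= alg_num_field fmorph_rat.
have memE (a : {poly rat}) :
    (map_poly (in_alg dp_model) a).[z1] \in <<1; z1>>%VS.
  by apply: mempx_Fadjoin; apply/polyOver1P; exists a.
split=> [[a [b ->]]|[x /Fadjoin_polyP[q /polyOver1P[a ->] ->] <-]].
  exists ((map_poly (in_alg dp_model) a).[z1]
           / (map_poly (in_alg dp_model) b).[z1]).
    exact: rpred_div.
  by rewrite fmorph_div !hornE.
by exists a, 1; rewrite rmorph1 hornerC divr1 hornE.
Qed.

Lemma dp_splitP : p != 0 -> laurent_over (Qadj z) p ->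
  exists P, [/\ P \is a polyOver dp_base, map_poly (nf_emb dp_model) P = lpoly p
              & splittingFieldFor dp_base P dp_split].
Proof.
move=> p0 Kp; have [_ rE] := dp_gens.
have [c cP] : exists c : int -> dp_model,
    forall j, c j \in dp_base /\ nf_emb dp_model (c j) = p@_j.
  have ex j : exists x, (x \in dp_base) && (nf_emb dp_model x == p@_j).
    have /dp_baseP[x xK xE] := Kp j.
    by exists x; rewrite xK xE eqxx.
  exists (fun j => xchoose (ex j)) => j.
  by have /andP[? /eqP] := xchooseP (ex j).
pose P : {poly dp_model} :=
  \poly_(i < (lshift p).*2.+1) c (i%:Z - (lshift p)%:Z).
have PE : map_poly (nf_emb dp_model) P = lpoly p.
  apply/polyP=> i; rewrite coef_map !coef_poly; case: ifP => _ /=.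
    by have [_ ->] := cP (i%:Z - (lshift p)%:Z).
  by rewrite rmorph0.
exists P; split=> //.
  apply/polyOverP=> i; rewrite coef_poly; case: ifP => _; last exact: mem0v.
  by have [] := cP (i%:Z - (lshift p)%:Z).
exists (behead (nf_gens dp_model)) => //.
have lpE : lpoly p = lead_coef (lpoly p) *:
    \prod_(y <- map (nf_emb dp_model) (behead (nf_gens dp_model))) ('X - y%:P).
  by rewrite rE; apply: svalP (closed_field_poly_normal (lpoly p)).
rewrite -(eqp_map (nf_emb dp_model)) PE {1}lpE big_map rmorph_prod /=.
under [X in _ %= X]eq_bigr => y _ do rewrite map_polyXsubC.
rewrite eqp_scale // lead_coef_eq0; apply: contra_neq p0 => lp0.
apply/malgP=> j; rewrite mcoeff0; have [jp|] := boolP (j \in msupp p); last first.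
  exact: mcoeff_outdom.
have jle := lshift_ge jp.
have /(congr1 (fun q : {poly algC} => q`_(`|(j + (lshift p)%:Z)%R|%N))) := lp0.
rewrite coef0 coef_poly ifT; last by lia.
by rewrite (_ : _ - _ = j) //; lia.
Qed.

Lemma dp_galois : p != 0 -> laurent_over (Qadj z) p -> galois dp_base dp_split.
Proof.
move=> p0 Kp; have sKL : (dp_base <= dp_split)%VS by apply: subv_adjoin_seq.
have sepKL : separable dp_base dp_split.
  apply/separableP=> y _; apply: pcharf0_separable => q.
  by rewrite pchar_lalg pchar_num.
rewrite /galois sKL sepKL /=.
have [P [PK _ splitP]] := dp_splitP p0 Kp.
by apply/splitting_normalField => //; exists P.
Qed.

End DPoly.

(* Main.v *)
(* A nonzero Laurent polynomial over C is determined up to a unit by the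
   multiplicities of its nonzero roots, and the bar involution moves a root r
   to 1/r^*.  If f = u g gbar over Q(zeta_{2^oo}) and p_i is self-conjugate
   with e_i = 2m+1, then the multiplicities in g of a root r of p_i and of
   1/r^* add up to 2m+1, so exactly one of them exceeds m.  The roots of p_i of
   multiplicity > m in g are those of h = gcd(p_i, g / gcd(g, p_i^m)), so p_i
   is an associate of h hbar.  The coefficients of the monic h lie in some
   Q(zeta_{2^N}) and in the splitting field L of p = p_i.

   Let x be in Q(zeta_{2^N}) and in L, with stabilizer H in G = Gal(L/K).
   Since (Z/2^N)^* is generated by -1 and 5, G/H is generated by commuting a
   and b with a^2 = 1 and b of order 2^s, hence is Z/2^s or Z/2 x Z/2^s.  So
   s <= d(p), and x is fixed by the 2^d(p)-th power of the automorphism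
   inducing b; this forces x into Q(zeta_{2^(n + d(p) + 1)}). *)

Require Import Defs.
From mathcomp Require Import all_boot all_order all_algebra all_fingroup.
From mathcomp Require Import all_solvable all_field.
From mathcomp Require Import finmap monalg zify ring.

Set Implicit Arguments.
Unset Strict Implicit.
Unset Printing Implicit Defensive.

Import Order.TTheory GRing.Theory Num.Theory.
Local Open Scope ring_scope.

(** * Laurent polynomials and their nonzero roots *)

Section LaurentPoly.
Variable F : fieldType.
Implicit Types (g h : laurent F) (P Q : {poly F}).

Definition lmon (c : F) (j : int) : laurent F := << c *g j >>.

Lemma lmonM c d i j : lmon c i * lmon d j = lmon (c * d) (i + j).
Proof. exact: laurentUU. Qed.

Lemma lmonE c j : << c *g j >> = lmon c j.
Proof. by []. Qed.

Lemma mcoeff_lmon c j k : (lmon c j)@_k = c *+ (j == k).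
Proof. exact: mcoeffU. Qed.

Lemma lmon0 j : lmon 0 j = 0.
Proof. exact: monalgU0. Qed.

Lemma lmonN c j : lmon (- c) j = - lmon c j.
Proof. exact: monalgUN. Qed.

Lemma lmon10 : lmon 1 0 = 1.
Proof. by []. Qed.

Lemma lmonK c j : c != 0 -> lmon c j * lmon c^-1 (- j) = 1.
Proof. by move=> c0; rewrite lmonM divff // subrr. Qed.

Lemma mcoeff_lmonM c i h j : (lmon c i * h)@_j = c * h@_(j - i).
Proof.
rewrite -[lmon c i * h]/(lmul << c *g i >> h) lmulUl raddf_sum /=.
have ijE k : (i + k == j) = (k == j - i) by apply/eqP/eqP; lia.
have [jh|/mcoeff_outdom hj] := boolP (j - i \in msupp h).
  rewrite (big_fsetD1 (j - i)) //= mcoeffU ijE eqxx mulr1n.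
  rewrite big1_fset ?addr0 // => k; rewrite in_fsetD1 mcoeffU ijE.
  by case/andP=> /negPf->.
rewrite hj mulr0 big1_fset // => k kh _; rewrite mcoeffU ijE.
by case: eqP kh => // ->; rewrite -mcoeff_neq0 hj eqxx.
Qed.

Lemma lmonX n j : lmon 1 j ^+ n = lmon 1 (j *+ n).
Proof.
elim: n => [|n IH]; first by rewrite expr0 mulr0n lmon10.
by rewrite exprS IH lmonM mul1r mulrS.
Qed.

(** Encoded as evaluation at [t], so that multiplicativity comes from that of [map_poly] and of
    [horner]. *)
Definition lofpoly P : laurent F :=
  (map_poly (in_alg (laurent F)) P).[lmon 1 1].

Lemma mcoeff_lofpoly P (j : int) :
  (lofpoly P)@_j = if j is Posz i then P`_i else 0.
Proof.
rewrite /lofpoly horner_coef raddf_sum /=.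
rewrite (eq_bigr (fun i : 'I__ => P`_i *+ (i%:Z == j))); last first.
  move=> i _; rewrite lmonX coef_map /= -scalerAl mul1r mcoeffZ mcoeffU.
  by rewrite -mulr_natr mul1r natz mulr_natr.
case: j => i; last by rewrite big1.
rewrite size_map_poly; have [lt_i|ge_i] := ltnP i (size P).
  rewrite (bigD1 (Ordinal lt_i)) //= eqxx big1 ?addr0 // => k ki.
  by have /negPf-> : (k : int) != i; rewrite // eqz_nat.
by rewrite nth_default // big1 // => k _;
  rewrite eqz_nat ltn_eqF ?mulr0n // (leq_trans (ltn_ord k)).
Qed.

Lemma lofpoly1 : lofpoly 1 = 1.
Proof. by rewrite /lofpoly rmorph1 hornerC. Qed.

Lemma lofpolyM : {morph lofpoly : P Q / P * Q}.
Proof. by move=> P Q; rewrite /lofpoly rmorphM hornerM. Qed.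

Lemma lofpoly_Xn n : lofpoly 'X^n = lmon 1 n.
Proof.
by rewrite /lofpoly map_polyXn hornerXn lmonX -mulr_natr mul1r natz.
Qed.

Lemma lofpoly_inj : injective lofpoly.
Proof.
move=> P Q PQ; apply/polyP => i.
by have := congr1 (fun g : laurent F => g@_(Posz i)) PQ;
  rewrite !mcoeff_lofpoly.
Qed.

(** Reduces Laurent polynomials to ordinary ones: up to a power of [t], which is a unit, every [g]
    is a polynomial. *)
Lemma lofpoly_lpoly g : g = lmon 1 (- (Defs.lshift g)%:Z) * lofpoly (lpoly g).
Proof.
apply/malgP => j; rewrite mcoeff_lmonM mul1r opprK mcoeff_lofpoly.
have [jg|jg] := boolP (j \in msupp g).
  have jle := Defs.lshift_ge jg.
  have -> : (j + (Defs.lshift g)%:Z) = `|(j + (Defs.lshift g)%:Z)%R|%N :> int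
    by lia.
  by rewrite coef_poly ifT; [congr (g@_ _); lia|lia].
rewrite mcoeff_outdom //; case E: (j + (Defs.lshift g)%:Z) => [i|//].
rewrite coef_poly -E addrK mcoeff_outdom //; by case: ifP.
Qed.

Lemma lpoly_eq0 g : (lpoly g == 0) = (g == 0).
Proof.
apply/eqP/eqP => [g0|->]; last first.
  by apply/polyP => i; rewrite coef_poly mcoeff0 coef0 if_same.
rewrite (lofpoly_lpoly g) g0 -(mulr0 (lmon 1 (- (Defs.lshift g)%:Z)));
  congr (_ * _).
by apply/malgP => -[i|i]; rewrite mcoeff_lofpoly mcoeff0 ?coef0.
Qed.

End LaurentPoly.

(* Otherwise unification unfolds Laurent products down to big operators. *)
Opaque lmul lmon lofpoly.

Section LaurentDomain.
Variable F : fieldType.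
Implicit Types (g h : laurent F) (P Q : {poly F}) (r : F).

Lemma lofpolyC (c : F) : lofpoly c%:P = lmon c 0.
Proof.
by apply/malgP => -[[|i]|i]; rewrite mcoeff_lofpoly mcoeff_lmon ?coefC.
Qed.

Lemma lofpolyZ c P : lofpoly (c *: P) = lmon c 0 * lofpoly P.
Proof. by rewrite -mul_polyC lofpolyM lofpolyC. Qed.

Lemma lofpoly_XsubC (a : F) : lofpoly ('X - a%:P) = lmon 1 1 - lmon a 0.
Proof.
apply/malgP => -[[|[|i]]|i];
  rewrite mcoeff_lofpoly mcoeffB !mcoeff_lmon ?coefB ?coefX ?coefC ?subr0
    ?sub0r //=.
Qed.

Lemma lmon_mulI c j : c != 0 -> injective (fun g => lmon c j * g).
Proof.
move=> c0 g h /(congr1 (fun x => lmon c^-1 (- j) * x)).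
by rewrite !mulrA [_ * lmon c j]mulrC lmonK // !mul1r.
Qed.

Lemma lofpoly_eq0 P : (lofpoly P == 0) = (P == 0).
Proof.
rewrite -(inj_eq (@lofpoly_inj F)); congr (_ == _).
by rewrite -[0 in RHS](scale0r 1) lofpolyZ lmon0 mul0r.
Qed.

Lemma lmon_mul_eq0 c j g : c != 0 -> (lmon c j * g == 0) = (g == 0).
Proof.
by move=> c0; rewrite -(inj_eq (lmon_mulI (j := j) c0) g) /= mulr0.
Qed.

(** Yields both the absence of zero divisors and the additivity of multiplicities from the same
    facts in [{poly F}]. *)
Lemma lmulE g h : g * h =
  lmon 1 (- (Defs.lshift g)%:Z - (Defs.lshift h)%:Z)
    * lofpoly (lpoly g * lpoly h).
Proof.
rewrite {1}(lofpoly_lpoly g) {1}(lofpoly_lpoly h) mulrACA lmonM mul1r.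
by rewrite lofpolyM.
Qed.

Lemma lmul_eq0 g h : (g * h == 0) = (g == 0) || (h == 0).
Proof.
by rewrite lmulE lmon_mul_eq0 ?oner_eq0 // lofpoly_eq0 mulf_eq0 !lpoly_eq0.
Qed.

Lemma lexp_neq0 g n : g != 0 -> g ^+ n != 0.
Proof.
move=> g0; elim: n => [|n IH]; first by rewrite expr0 oner_eq0.
by rewrite exprS lmul_eq0 (negPf g0).
Qed.

Lemma lprod_neq0 (I : Type) (s : seq I) (G : I -> laurent F) :
  (forall i, G i != 0) -> \prod_(i <- s) G i != 0.
Proof.
move=> G0; elim/big_rec: _ => [|i g _ g0]; first exact: oner_neq0.
by rewrite lmul_eq0 (negPf g0) (negPf (G0 i)).
Qed.

(** The zero roots are split off because their factor [X^k] becomes a unit in the Laurent ring. *)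
Lemma lsplit_poly (s : seq F) : exists k,
  \prod_(a <- s) ('X - a%:P) =
    'X^k * \prod_(a <- [seq a <- s | a != 0]) ('X - a%:P).
Proof.
elim: s => [|a s [k IH]]; first by exists 0%N; rewrite !big_nil mul1r.
rewrite big_cons IH /=; case: eqP => [->|_] /=.
  by exists k.+1; rewrite subr0 exprS mulrA.
by exists k; rewrite big_cons mulrCA.
Qed.

(* Only meaningful for r != 0: lpoly g may differ from g by a power of t. *)
Definition lmu r g := mup r (lpoly g).

Lemma mup_mulXn r c a b P Q : r != 0 -> c != 0 ->
  'X^b * Q = (c%:P * 'X^a) * P -> mup r Q = mup r P.
Proof.
move=> r0 c0 /(congr1 (mup r)).
have nrX k : ~~ root ('X^k : {poly F}) r.
  by rewrite /root hornerXn expf_eq0 (negPf r0) andbF.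
by rewrite !mupMr // rootM rootC (negPf c0) (negPf (nrX _)).
Qed.

(** A nonzero [r] is no root of a power of [X], so any polynomial representative of a Laurent
    polynomial computes [lmu]. *)
Lemma lmu_poly r c m P : r != 0 -> c != 0 -> P != 0 ->
  lmu r (lmon c m * lofpoly P) = mup r P.
Proof.
move=> r0 c0 P0; set g := _ * _.
have := lofpoly_lpoly g; set S := Defs.lshift g => gE.
(* The extra factor [t^|m|] keeps both exponents natural when [m] is negative. *)
have [a [b abE]] : exists a b : nat, b%:Z + S%:Z + m = a%:Z.
  by exists `|(m + S%:Z + `|m|%N%:Z)%R|%N, `|m|%N; lia.
have PE : 'X^b * lpoly g = (c%:P * 'X^a) * P.
  apply: lofpoly_inj; rewrite !lofpolyM lofpolyC !lofpoly_Xn lmonM mulr1 add0r.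
  have -> : lofpoly (lpoly g) = lmon 1 S%:Z * g.
    by rewrite [in RHS]gE mulrA lmonM mul1r subrr lmon10 mul1r.
  have bSm : lmon 1 b * (lmon 1 S * lmon c m) = lmon c (b%:Z + S%:Z + m).
    by rewrite !lmonM !mul1r addrA.
  rewrite /g (mulrA (lmon 1 S)) (mulrA (lmon 1 b)) bSm abE; reflexivity.
exact: mup_mulXn PE.
Qed.

Lemma lmuM r g h : r != 0 -> g != 0 -> h != 0 ->
  lmu r (g * h) = (lmu r g + lmu r h)%N.
Proof.
move=> r0 g0 h0; rewrite lmulE lmu_poly ?oner_eq0 ?mupM ?lpoly_eq0 //.
by rewrite mulf_neq0 ?lpoly_eq0.
Qed.

Lemma lmu_lmon r c m : r != 0 -> c != 0 -> lmu r (lmon c m) = 0%N.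
Proof.
move=> r0 c0; rewrite -[lmon c m]mulr1 -lofpoly1 lmu_poly ?oner_eq0 //.
by rewrite mupNroot // root1.
Qed.

Lemma lmu1 r : r != 0 -> lmu r 1 = 0%N.
Proof. by move=> r0; rewrite -lmon10 lmu_lmon ?oner_eq0. Qed.

Lemma lmuX r g n : r != 0 -> g != 0 -> lmu r (g ^+ n) = (n * lmu r g)%N.
Proof.
move=> r0 g0; elim: n => [|n IH]; first by rewrite expr0 lmu1.
by rewrite exprS lmuM ?lexp_neq0 // IH mulSn.
Qed.

Lemma lmu_prod (I : Type) (s : seq I) (G : I -> laurent F) r :
    r != 0 -> (forall i, G i != 0) ->
  lmu r (\prod_(i <- s) G i) = (\sum_(i <- s) lmu r (G i))%N.
Proof.
move=> r0 G0; elim: s => [|i s IH]; first by rewrite !big_nil lmu1.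
by rewrite !big_cons lmuM ?lprod_neq0 // IH.
Qed.

Lemma lmu_unit r u v : r != 0 -> u * v = 1 -> lmu r u = 0%N.
Proof.
move=> r0 uv; have : u * v != 0 by rewrite uv oner_eq0.
rewrite lmul_eq0 negb_or => /andP[u0 v0].
by have := lmu1 r0; rewrite -uv lmuM // => /eqP;
  rewrite addn_eq0 => /andP[/eqP].
Qed.

Lemma mup_prod_XsubC r (s : seq F) :
  mup r (\prod_(a <- s) ('X - a%:P)) = count_mem r s.
Proof.
elim: s => [|a s IH]; first by rewrite big_nil mupNroot ?root1.
rewrite big_cons mupM ?polyXsubC_eq0 ?monic_neq0 ?monic_prod_XsubC // IH /=.
by have := mup_XsubCX 1 r a; rewrite expr1 => ->; case: eqP.
Qed.

Lemma lmu_split r c m s : r != 0 -> c != 0 ->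
  lmu r (lmon c m * lofpoly (\prod_(a <- s) ('X - a%:P))) = count_mem r s.
Proof.
by move=> r0 c0; rewrite lmu_poly ?mup_prod_XsubC // monic_neq0
  ?monic_prod_XsubC.
Qed.

End LaurentDomain.

Lemma lsplitP (F : closedFieldType) (g : laurent F) : g != 0 -> exists c m s,
  [/\ c != 0, 0 \notin s & g = lmon c m * lofpoly (\prod_(a <- s) ('X - a%:P))].
Proof.
move=> g0; have [s gE] := closed_field_poly_normal (lpoly g).
have [k sE] := lsplit_poly s.
exists (lead_coef (lpoly g)), (- (Defs.lshift g)%:Z + k%:Z),
  [seq a <- s | a != 0].
split; first by rewrite lead_coef_eq0 lpoly_eq0.
  by rewrite mem_filter eqxx.
rewrite {1}(lofpoly_lpoly g) {1}gE {1}sE lofpolyZ lofpolyM lofpoly_Xn !mulrA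
  !lmonM.
by rewrite mul1r addr0 mulr1.
Qed.

(** * The bar involution and its effect on roots *)

Section Bar.
Implicit Types (g h : laurent algC) (r : algC).

(** Inversion in the unit circle. Since [0^-1 = 0], it is an involution on all of [algC]. *)
Definition recip_conj r : algC := (r^*)^-1.

Lemma recip_conjK : involutive recip_conj.
Proof. by move=> r; rewrite /recip_conj fmorphV invrK /= conjCK. Qed.

Lemma recip_conj_eq0 r : (recip_conj r == 0) = (r == 0).
Proof. by rewrite invr_eq0 conjC_eq0. Qed.

Lemma lbarD : {morph lbar : g h / g + h}.
Proof. by move=> g h; apply/malgP => j;
  rewrite mcoeffD !mcoeff_lbar mcoeffD rmorphD. Qed.

Lemma lbar0 : lbar 0 = 0.
Proof. by apply/malgP => j; rewrite mcoeff_lbar !mcoeff0 rmorph0. Qed.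

Lemma lbarK : involutive lbar.
Proof. by move=> g; apply/malgP => j; rewrite !mcoeff_lbar opprK conjCK. Qed.

Lemma lbar_eq0 g : (lbar g == 0) = (g == 0).
Proof. by rewrite -[X in lbar g == X]lbar0 (inj_eq (inv_inj lbarK)). Qed.

Lemma lbar_lmon c j : lbar (lmon c j) = lmon c^* (- j).
Proof.
apply/malgP => k; rewrite mcoeff_lbar !mcoeff_lmon eqr_oppLR.
by case: eqP; rewrite ?rmorph0.
Qed.

Lemma lbar1 : lbar 1 = 1.
Proof. by rewrite -lmon10 lbar_lmon rmorph1. Qed.

Lemma lbarM : {morph lbar : g h / g * h}.
Proof.
move=> g h; rewrite [g]monalgE mulr_suml !(big_morph _ lbarD lbar0) mulr_suml.
apply: eq_bigr => i _; apply/malgP => j.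
rewrite mcoeff_lbar lmonE mcoeff_lmonM lbar_lmon mcoeff_lmonM.
by rewrite mcoeff_lbar rmorphM opprK opprD.
Qed.

Lemma lbarX g n : lbar (g ^+ n) = lbar g ^+ n.
Proof. by elim: n => [|n IH]; rewrite ?expr0 ?lbar1 // !exprS lbarM IH. Qed.

(** With [b] the conjugate of [a], this is [t^-1 - b = - b t^-1 (t - 1/b)]. *)
Lemma lbar_XsubC a : a != 0 -> lbar (lofpoly ('X - a%:P)) =
  lmon (- a^*) (-1) * lofpoly ('X - (recip_conj a)%:P).
Proof.
move=> a0; rewrite !lofpoly_XsubC mulrBr !lmonM -!lmonN lbarD !lbar_lmon
  /recip_conj.
rewrite rmorph1 rmorphN oppr0 mulr1 mulNr divff ?conjC_eq0 //.
by rewrite addNr addr0 opprK addrC.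
Qed.

Lemma lbar_split c m (s : seq algC) : c != 0 -> 0 \notin s -> exists c' m',
  c' != 0 /\ lbar (lmon c m * lofpoly (\prod_(a <- s) ('X - a%:P))) =
    lmon c' m' * lofpoly (\prod_(a <- map recip_conj s) ('X - a%:P)).
Proof.
move=> c0; elim: s => [|a s IH].
  by exists c^*, (- m); rewrite conjC_eq0 !big_nil lofpoly1 !mulr1 lbar_lmon.
rewrite inE negb_or eq_sym => /andP[a0 s0]; have [c' [m' [c'0 E]]] := IH s0.
exists (- a^* * c'), (-1 + m'); split.
  by rewrite mulf_neq0 // oppr_eq0 conjC_eq0.
rewrite map_cons !big_cons !lofpolyM (mulrCA (lmon c m)) lbarM E.
by rewrite (lbar_XsubC a0) mulrACA lmonM.
Qed.

Lemma lmu_bar r g : r != 0 -> g != 0 -> lmu r (lbar g) = lmu (recip_conj r) g.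
Proof.
move=> r0 /lsplitP[c [m [s [c0 s0 ->]]]].
have [c' [m' [c'0 ->]]] := lbar_split m c0 s0.
rewrite !lmu_split ?recip_conj_eq0 // count_map.
by apply: eq_count => a /=; rewrite (can2_eq recip_conjK recip_conjK).
Qed.

End Bar.

(** * Units, associates and polynomials over a subfield of C *)

Record subfieldC (F : algC -> Prop) : Prop := SubfieldC {
  subfieldC1 : F 1;
  subfieldCB : forall x y, F x -> F y -> F (x - y);
  subfieldCM : forall x y, F x -> F y -> F (x * y);
  subfieldCV : forall x, F x -> F x^-1
}.

Section LaurentOver.
Variable F : algC -> Prop.
Hypothesis sF : subfieldC F.
Implicit Types (g h u : laurent algC) (P Q : {poly algC}).

Lemma subfieldC0 : F 0.
Proof. by rewrite -(subrr 1); apply: (subfieldCB sF); apply: subfieldC1. Qed.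

Lemma subfieldCD x y : F x -> F y -> F (x + y).
Proof.
move=> Fx Fy; rewrite -[y]opprK; apply: (subfieldCB sF) => //.
by rewrite -sub0r; apply: (subfieldCB sF) => //; apply: subfieldC0.
Qed.

Lemma lover_lmon c j : F c -> laurent_over F (lmon c j).
Proof.
by move=> Fc k; rewrite mcoeff_lmon; case: eqP => _;
  rewrite ?mulr1n ?mulr0n //; apply: subfieldC0.
Qed.

Lemma lover1 : laurent_over F 1.
Proof. exact/lover_lmon/(subfieldC1 sF). Qed.

Lemma loverM g h : laurent_over F g -> laurent_over F h ->
  laurent_over F (g * h).
Proof.
move=> Fg Fh k; rewrite [g]monalgE mulr_suml raddf_sum /=.
elim/big_rec: _ => [|i x _ Fx]; first exact: subfieldC0.
apply: subfieldCD => //; rewrite lmonE mcoeff_lmonM.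
exact: (subfieldCM sF).
Qed.

Lemma loverX g n : laurent_over F g -> laurent_over F (g ^+ n).
Proof.
move=> Fg; elim: n => [|n IH]; first exact: lover1.
by rewrite exprS; apply: loverM.
Qed.

Lemma lover_lofpoly P : laurent_over F (lofpoly P) <-> forall i, F P`_i.
Proof.
split=> FP => [i|[i|i]]; last 2 [by rewrite mcoeff_lofpoly].
- by have := FP i%:Z; rewrite mcoeff_lofpoly.
by rewrite mcoeff_lofpoly; apply: subfieldC0.
Qed.

Lemma lover_lpoly g i : laurent_over F g -> F (lpoly g)`_i.
Proof.
by move=> Fg; rewrite coef_poly; case: ifP => _ //; apply: subfieldC0.
Qed.

Lemma lunit_lmon c j : F c -> c != 0 -> lunit F (lmon c j).
Proof.
move=> Fc c0; split; first exact: lover_lmon.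
exists (lmon c^-1 (- j)); last exact: lmonK.
by apply: lover_lmon; apply: (subfieldCV sF).
Qed.

Lemma lunit1 : lunit F 1.
Proof. by apply: (lunit_lmon 0); rewrite ?oner_eq0 //; apply: subfieldC1. Qed.

Lemma lunitM u v : lunit F u -> lunit F v -> lunit F (u * v).
Proof.
case=> Fu [u' Fu' uE] [Fv [v' Fv' vE]]; split; first exact: loverM.
by exists (u' * v'); [apply: loverM|rewrite mulrACA uE vE mulr1].
Qed.

Lemma lunitV u v : lunit F u -> laurent_over F v -> u * v = 1 -> lunit F v.
Proof. by case=> Fu _ Fv uv; split => //; exists u; rewrite // mulrC. Qed.

Lemma lunit_neq0 u : lunit F u -> u != 0.
Proof.
case=> _ [v _ uv]; apply/eqP => u0.
by have := oner_neq0 (laurent algC); rewrite -uv u0 mul0r eqxx.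
Qed.

Lemma lunit_lmu r u : r != 0 -> lunit F u -> lmu r u = 0%N.
Proof. by move=> r0 [_ [v _ /lmu_unit]]; apply. Qed.

Lemma lassociate_sym g h : lassociate F g h -> lassociate F h g.
Proof.
case=> u Uu gE; case: (Uu) => Fu [v Fv uv]; exists v; first exact: lunitV uv.
by rewrite gE mulrA [v * u]mulrC uv mul1r.
Qed.

Lemma lassociate_trans g1 g2 g3 :
  lassociate F g1 g2 -> lassociate F g2 g3 -> lassociate F g1 g3.
Proof.
move=> [u Uu ->] [v Uv ->]; exists (u * v); first exact: lunitM.
by rewrite mulrA.
Qed.

Lemma lassociate_lmu r g h : r != 0 -> h != 0 -> lassociate F g h ->
  lmu r g = lmu r h.
Proof.
move=> r0 h0 [u Uu ->].
by rewrite lmuM ?(lunit_neq0 Uu) // (lunit_lmu r0 Uu).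
Qed.

(** Equal multiplicities give the same linear factors, so [g] and [h] differ by a monomial; the
    point is that its scalar lies in [F]. *)
Lemma lmu_lassociate g h : laurent_over F g -> laurent_over F h ->
    g != 0 -> h != 0 -> (forall r, r != 0 -> lmu r g = lmu r h) ->
  lassociate F g h.
Proof.
move=> Fg Fh g0 h0 E; have [c [m [s [c0 s0 gE]]]] := lsplitP g0.
have [d [l [t [d0 t0 hE]]]] := lsplitP h0.
have st : perm_eq s t.
  apply/allP => a _ /=; have [->|a0] := eqVneq a 0.
    by rewrite !(count_memPn _).
  by rewrite -(lmu_split m s a0 c0) -(lmu_split l t a0 d0) -gE -hE E.
have stE : \prod_(a <- s) ('X - a%:P) = \prod_(a <- t) ('X - a%:P).
  exact: perm_big.
have ghE : g = lmon (c / d) (m - l) * h.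
  rewrite gE hE (mulrA (lmon (c / d) (m - l))) lmonM (divfK d0) subrK.
  rewrite stE; reflexivity.
have [j hj] : exists j, h@_j != 0.
  have [E0|[j jh]] := fset_0Vmem (msupp h); last by exists j;
    rewrite mcoeff_neq0.
  by case/eqP: h0; apply/malgP => j; rewrite mcoeff0 mcoeff_outdom // E0.
(* The scalar, a priori only in [algC], is a ratio of a coefficient of [g] to one of [h]. *)
have cdE : c / d = g@_(j + (m - l)) / h@_j.
  by rewrite ghE mcoeff_lmonM addrK mulfK.
exists (lmon (c / d) (m - l)) => //; apply: lunit_lmon.
  by rewrite cdE; apply: (subfieldCM sF) => //; apply: (subfieldCV sF).
by rewrite mulf_neq0 ?invr_eq0.
Qed.

(** Without nonzero roots [g] would be a monomial whose scalar is one of its coefficients, hence a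
    unit over [F]. *)
Lemma nonunit_root g : laurent_over F g -> g != 0 -> ~ lunit F g ->
  exists2 r, r != 0 & (0 < lmu r g)%N.
Proof.
move=> Fg g0 nUg; have [c [m [[|a s] [c0 s0 gE]]]] := lsplitP g0.
  case: nUg; rewrite gE big_nil lofpoly1 mulr1.
  apply: lunit_lmon => //; have := Fg m.
  by rewrite gE big_nil lofpoly1 mulr1 mcoeff_lmon eqxx.
move: s0; rewrite inE negb_or eq_sym => /andP[a0 _].
by exists a; rewrite // gE lmu_split //= eqxx.
Qed.

End LaurentOver.

Opaque lbar lpoly.

(** As the image of an abstract field, the predicate [F] inherits gcds, quotients and derivatives of
    polynomials, all of which commute with field embeddings. *)
Definition field_image (F : algC -> Prop) : Prop :=
  exists (E : fieldType) (iota : {rmorphism E -> algC}),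
    forall x, F x <-> exists y, iota y = x.

Definition poly_over (F : algC -> Prop) (P : {poly algC}) : Prop :=
  forall i, F P`_i.

Section FieldImage.
Variable F : algC -> Prop.
Hypothesis imF : field_image F.

Lemma field_image_subfieldC : subfieldC F.
Proof.
have [E [iota FE]] := imF; split.
- by apply/FE; exists 1; rewrite rmorph1.
- by move=> _ _ /FE[x <-] /FE[y <-]; apply/FE; exists (x - y); rewrite rmorphB.
- by move=> _ _ /FE[x <-] /FE[y <-]; apply/FE; exists (x * y); rewrite rmorphM.
by move=> _ /FE[x <-]; apply/FE; exists x^-1; rewrite fmorphV.
Qed.

Lemma poly_over_image : exists (E : fieldType) (iota : {rmorphism E -> algC}),
  forall P, poly_over F P <-> exists Q, map_poly iota Q = P.
Proof.
have [E [iota FE]] := imF; exists E, iota => P; split=> [FP|[Q <-] i].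
  have ex i : exists y, iota y == P`_i by have /FE[y <-] := FP i; exists y.
  exists (\poly_(i < size P) xchoose (ex i)); apply/polyP => i.
  rewrite coef_map coef_poly; case: ltnP => [_|le_i].
    exact/eqP/(xchooseP (ex i)).
  by rewrite /= rmorph0 nth_default.
by apply/FE; exists Q`_i; rewrite coef_map.
Qed.

Lemma poly_over_gcdp P Q : poly_over F P -> poly_over F Q ->
  poly_over F (gcdp P Q).
Proof.
have [E [iota FE]] := poly_over_image.
by move=> /FE[P' <-] /FE[Q' <-]; apply/FE; exists (gcdp P' Q');
  rewrite gcdp_map.
Qed.

Lemma poly_over_divp P Q : poly_over F P -> poly_over F Q ->
  poly_over F (P %/ Q).
Proof.
have [E [iota FE]] := poly_over_image.
by move=> /FE[P' <-] /FE[Q' <-]; apply/FE; exists (P' %/ Q'); rewrite map_divp.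
Qed.

Lemma poly_over_exp P n : poly_over F P -> poly_over F (P ^+ n).
Proof.
have [E [iota FE]] := poly_over_image.
by move=> /FE[P' <-]; apply/FE; exists (P' ^+ n); rewrite rmorphXn.
Qed.

Lemma poly_over_deriv P : poly_over F P -> poly_over F P^`().
Proof.
have [E [iota FE]] := poly_over_image.
by move=> /FE[P' <-]; apply/FE; exists P'^`(); rewrite deriv_map.
Qed.

End FieldImage.

(** * Irreducible Laurent polynomials and their roots *)

Lemma mup_gt0 (F : fieldType) (r : F) P : P != 0 -> (0 < mup r P)%N = root P r.
Proof. by move=> P0; rewrite mup_geq // expr1 dvdp_XsubCl. Qed.

Lemma lmu_gt0 (F : fieldType) (r : F) g : g != 0 ->
  (0 < lmu r g)%N = root (lpoly g) r.
Proof. by move=> g0; rewrite mup_gt0 // lpoly_eq0. Qed.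

(** Write [P = Q (X - r)^k] with [k] the multiplicity. If [(X - r)^k] divided [P'], it would divide
    [k Q (X - r)^(k-1)], so [X - r] would divide [Q] in characteristic 0. *)
Lemma mup_deriv (F : numFieldType) (r : F) P :
  root P r -> P^`() != 0 -> (mup r P^`() < mup r P)%N.
Proof.
move=> rP dP0; have P0 : P != 0 by apply: contra_neq dP0 => ->; rewrite deriv0.
rewrite mup_ltn //; have k_gt0 : (0 < mup r P)%N by rewrite mup_gt0.
have : ('X - r%:P) ^+ mup r P %| P by rewrite -mup_geq.
have : ~~ (('X - r%:P) ^+ (mup r P).+1 %| P) by rewrite -mup_ltn.
case: (mup r P) k_gt0 => // k _ ndvP /dvdpP[Q PE].
apply: contra ndvP; rewrite PE derivM deriv_exp derivXsubC mul1r /=.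
rewrite (dvdp_addr _ (dvdp_mull _ (dvdpp _))) -scaler_nat -scalerAr.
rewrite dvdpZr ?pnatr_eq0 // exprS dvdp_mul2r; last first.
  by rewrite expf_neq0 // polyXsubC_eq0.
by case/dvdpP => R ->; rewrite -mulrA -!exprS dvdp_mulIr.
Qed.

Section Irreducible.
Variable F : algC -> Prop.
Hypothesis imF : field_image F.
Let sF := field_image_subfieldC imF.
Implicit Types (p q a : laurent algC) (r : algC).

Lemma irreducible_root p : lirreducible F p ->
  exists2 r, r != 0 & (0 < lmu r p)%N.
Proof. by case=> Fp p0 nUp _; apply: (nonunit_root sF). Qed.

(** The gcd [D] of the two polynomials has coefficients in [F] and the root [r], so it is not a
    unit. Irreducibility makes [p] an associate of [D], which divides [a]. *)
Lemma irreducible_dvd p a r : lirreducible F p -> laurent_over F a -> a != 0 ->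
    r != 0 -> (0 < lmu r p)%N -> (0 < lmu r a)%N ->
  exists2 c, laurent_over F c & a = c * p.
Proof.
case=> Fp p0 nUp irr Fa a0 r0; rewrite !lmu_gt0 // => rp ra.
have Fpp : poly_over F (lpoly p) by move=> i; apply: (lover_lpoly sF).
have Fpa : poly_over F (lpoly a) by move=> i; apply: (lover_lpoly sF).
set D := gcdp (lpoly p) (lpoly a).
have FD : poly_over F D by apply: (poly_over_gcdp imF).
have rD : root D r by rewrite root_gcd rp.
have D0 : D != 0 by rewrite gcdp_eq0 negb_and lpoly_eq0 p0.
have fact g : laurent_over F g -> D %| lpoly g ->
    exists2 h, laurent_over F h & g = h * lofpoly D.
  move=> Fg dvDg; exists (lmon 1 (- (Defs.lshift g)%:Z) * lofpoly
    (lpoly g %/ D)).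
    apply: (loverM sF); first exact/(lover_lmon sF)/(subfieldC1 sF).
    apply/(lover_lofpoly sF)/(poly_over_divp imF) => //.
    by move=> i; apply: (lover_lpoly sF).
  by rewrite -mulrA -lofpolyM divpK // -lofpoly_lpoly.
have [h Fh pE] := fact p Fp (dvdp_gcdl _ _).
have [h' Fh' aE] := fact a Fa (dvdp_gcdr _ _).
have FlD : laurent_over F (lofpoly D) by apply/(lover_lofpoly sF).
case: (irr _ _ Fh FlD pE) => [[_ [v Fv hv]]|UD].
  exists (h' * v); first exact: (loverM sF).
  by rewrite aE pE -!mulrA; congr (_ * _); rewrite mulrA [v * h]mulrC hv mul1r.
have := lunit_lmu r0 UD;
  rewrite -[lofpoly D]mul1r -lmon10 lmu_poly ?oner_eq0 //.
by move/eqP; rewrite -leqn0 leqNgt mup_gt0 // rD.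
Qed.

Lemma irreducible_associate p q r : lirreducible F p -> lirreducible F q ->
    r != 0 -> (0 < lmu r p)%N -> (0 < lmu r q)%N ->
  lassociate F p q.
Proof.
move=> irrp irrq r0 rp rq; have [Fq q0 _ irr] := irrq.
have [c Fc qE] := irreducible_dvd irrp Fq q0 r0 rp rq.
have [Fp _ nUp _] := irrp.
case: (irr _ _ Fc Fp qE) => [Uc|/nUp[]].
by apply: lassociate_sym; exists c.
Qed.

(** A multiple root is shared with the derivative, so [p] would divide the derivative and [r] would
    have at least the same multiplicity there, against [mup_deriv]. *)
Lemma irreducible_lmu_le1 p r : lirreducible F p -> r != 0 -> (lmu r p <= 1)%N.
Proof.
move=> irrp r0; rewrite leqNgt; apply/negP => lmu_gt1.
have [Fp p0 _ _] := irrp; have P0 : lpoly p != 0 by rewrite lpoly_eq0.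
have rP : root (lpoly p) r by rewrite -lmu_gt0 // ltnW.
have dP0 : (lpoly p)^`() != 0.
  have := root_size_gt1 P0 rP; have := lead_coef_eq0 (lpoly p).
  rewrite lead_coefE; case: (size _) => [|[|m]] //= lcE _.
  apply/eqP => /(congr1 (fun Q : {poly algC} => Q`_m)) /eqP.
  by rewrite coef0 coef_deriv mulrn_eq0 lcE (negPf P0).
have lmuE : lmu r (lofpoly (lpoly p)^`()) = mup r (lpoly p)^`().
  by rewrite -[lofpoly _]mul1r -lmon10 lmu_poly ?oner_eq0.
have ltd := mup_deriv rP dP0.
have rdP : root (lpoly p)^`() r.
  have : ('X - r%:P) ^+ 2 %| lpoly p by rewrite -mup_geq.
  case/dvdpP => Q ->.
  rewrite /root expr2 !derivE hornerD !hornerM mul1r mulr1 -mulr2n hornerMn.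
  by rewrite hornerXsubC subrr mul0rn !mulr0 addr0.
have Fd : laurent_over F (lofpoly (lpoly p)^`()).
  apply/(lover_lofpoly sF)/(poly_over_deriv imF) => // i.
  exact: (lover_lpoly sF).
have d0 : lofpoly (lpoly p)^`() != 0 by rewrite lofpoly_eq0.
have lmu_d : (0 < lmu r (lofpoly (lpoly p)^`()))%N by rewrite lmuE mup_gt0.
have [c Fc dE] := irreducible_dvd irrp Fd d0 r0 (ltnW lmu_gt1) lmu_d.
have c0 : c != 0 by move: d0; rewrite dE lmul_eq0 negb_or => /andP[].
by have := ltd; rewrite -lmuE dE lmuM // ltnNge leq_addl.
Qed.

Lemma lirreducible_lbar p : (forall x, F x -> F x^*) ->
  lirreducible F p -> lirreducible F (lbar p).
Proof.
move=> Fconj [Fp p0 nUp irr].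
have Fbar g : laurent_over F g -> laurent_over F (lbar g).
  by move=> Fg j; rewrite mcoeff_lbar; apply: Fconj.
have Ubar g : lunit F (lbar g) -> lunit F g.
  case=> Fg [v Fv uv]; split; first by rewrite -[g]lbarK; apply: Fbar.
  by exists (lbar v); [apply: Fbar|rewrite -[g]lbarK -lbarM uv lbar1].
split; rewrite ?lbar_eq0 //; first exact: Fbar.
  by move=> /Ubar.
move=> a b Fa Fb pE; case: (irr (lbar a) (lbar b)); try exact: Fbar.
- by rewrite -lbarM -pE lbarK.
- by move=> /Ubar; left.
by move=> /Ubar; right.
Qed.

End Irreducible.

(** * Galois action on cyclotomic elements of a splitting field *)

Local Notation "a .[@ z ]" := (map_poly (ratr : rat -> algC) a).[z]
  (at level 2, left associativity, format "a .[@ z ]").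

Section Cyclotomic.
Implicit Types (z w x : algC) (a : {poly rat}).

Lemma Qadj_field z : exists (E : fieldExtType rat)
    (iota : {rmorphism E -> algC}),
  (forall x, Qadj z x <-> exists y, iota y = x) /\
  (forall y, exists a, iota y = a.[@ z]).
Proof.
have [E [iota [[|z1 [|? ?]] //= [zE] genE]]] := num_field_exists [:: z].
have hornE a : iota (map_poly (in_alg E) a).[z1] = a.[@ z].
  rewrite -horner_map /= zE -map_poly_comp; congr _.[z].
  by apply: eq_map_poly => b; rewrite /= alg_num_field fmorph_rat.
have polyE y : exists a, iota y = a.[@ z].
  have : y \in <<1; z1>>%VS by rewrite -adjoin_seq1 genE memvf.
  by case/Fadjoin_polyP => q /polyOver1P[a ->] ->; exists a.
exists E, iota; split=> // x; split=> [[a [b ->]]|[y <-]].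
  exists ((map_poly (in_alg E) a).[z1] / (map_poly (in_alg E) b).[z1]).
  by rewrite fmorph_div !hornE.
have [a ->] := polyE y.
by exists a, 1; rewrite rmorph1 hornerC divr1.
Qed.

Lemma QadjP z x : Qadj z x <-> exists a, x = a.[@ z].
Proof.
split=> [|[a ->]]; last by exists a, 1; rewrite rmorph1 hornerC divr1.
by have [E [iota [imE polyE]]] := Qadj_field z => /imE[y <-].
Qed.

Lemma Qadj_horner z w a : Qadj z w -> Qadj z a.[@ w].
Proof.
have [E [iota [imE _]]] := Qadj_field z => /imE[y <-]; apply/imE.
exists (map_poly (in_alg E) a).[y].
rewrite -horner_map /= -map_poly_comp; congr _.[_].
by apply: eq_map_poly => b; rewrite /= alg_num_field fmorph_rat.
Qed.

Lemma Qadj_trans z w x : Qadj z w -> Qadj w x -> Qadj z x.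
Proof. by move=> zw /QadjP[a ->]; apply: Qadj_horner. Qed.

Lemma Qadj_X z n : Qadj z (z ^+ n).
Proof. by apply/QadjP; exists 'X^n; rewrite map_polyXn hornerXn. Qed.

Lemma horner_aut (u : {rmorphism algC -> algC}) a z : u a.[@ z] = a.[@ u z].
Proof.
rewrite -horner_map -map_poly_comp; congr _.[_].
by apply: eq_map_poly => b; rewrite /= fmorph_rat.
Qed.

Lemma Qzeta2_root m w : w ^+ (2 ^ m) = 1 -> Qzeta2 m w.
Proof. by case/(prim_rootP (zeta2_prim m)) => i ->; apply: Qadj_X. Qed.

Lemma Qzeta2_mono m n x : (m <= n)%N -> Qzeta2 m x -> Qzeta2 n x.
Proof.
move=> le_mn; apply: Qadj_trans; apply: Qzeta2_root.
by rewrite -(subnKC le_mn) expnD exprM (prim_expr_order (zeta2_prim m)) expr1n.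
Qed.

Lemma Qzeta2_conj m x : Qzeta2 m x -> Qzeta2 m x^*.
Proof.
case/QadjP => a ->; rewrite (horner_aut Num.conj); apply: Qadj_horner.
apply: Qzeta2_root; rewrite -rmorphXn.
by rewrite (prim_expr_order (zeta2_prim m)) rmorph1.
Qed.

End Cyclotomic.

(** * Units modulo powers of two *)

Section PowersOfTwo.

(** Squaring [1 + 2^s c] with [c] odd gives [1 + 2^(s+1) (c + 2^(s-1) c^2)], and the new cofactor is
    odd because [s >= 2]. *)
Lemma exp_1add2 m i : (2 <= m)%N ->
  exists k, ((1 + 2 ^ m) ^ (2 ^ i) = 1 + 2 ^ (m + i) * k.*2.+1)%N.
Proof.
move=> m2; elim: i => [|i [k IH]].
  by exists 0%N; rewrite addn0 muln1 expn1.
exists (k + 2 ^ (m + i).-2 * k.*2.+1 ^ 2)%N.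
rewrite expnS mulnC expnM IH; have -> : (m + i.+1 = (m + i).-2.+3)%N by lia.
have -> : (m + i = (m + i).-2.+2)%N by lia.
by rewrite /= !expnS; set M := (2 ^ _)%N; rewrite -!muln2; ring.
Qed.

Lemma eq_mod_double M a b : (0 < M)%N -> (a = b %[mod M])%N ->
  (a = b %[mod M * 2])%N \/ (a = b + M %[mod M * 2])%N.
Proof.
move=> M0 ab; rewrite (divn_eq a M) (divn_eq b M) ab; set r := (b %% M)%N.
rewrite -(odd_double_half (a %/ M)) -(odd_double_half (b %/ M)).
set ha := (_./2); set hb := (_./2).
have red (s : bool) h t : ((s + h.*2) * M + r + t = s * M + r + t
  %[mod M * 2])%N.
  rewrite -[RHS](modnMDl h); congr (_ %% _)%N; rewrite -muln2; ring.
have redl (s : bool) h : ((s + h.*2) * M + r = s * M + r %[mod M * 2])%N.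
  by have := red s h 0%N; rewrite !addn0.
rewrite red !redl; case: (odd _); case: (odd _); rewrite ?mul0n ?mul1n.
- by left.
- by right; rewrite add0n addnC.
- right; rewrite add0n addnAC -addnA -[LHS](modnMDl 1); congr (_ %% _)%N; ring.
by left.
Qed.

(** The residues congruent to 1 modulo [2^m] are the powers of [1 + 2^m]; the exponent [j] is lifted
    one binary digit at a time. *)
Lemma exp_1add2_gen m N a : (2 <= m)%N -> (a = 1 %[mod 2 ^ m])%N ->
  exists j, (a = (1 + 2 ^ m) ^ j %[mod 2 ^ N])%N.
Proof.
move=> m2 a1; have [le_Nm|] := leqP N m.
  exists 0%N; rewrite expn0; have /(congr1 (fun x => x %% 2 ^ N)%N) := a1.
  by rewrite !modn_dvdm ?dvdn_exp2l.
move=> /ltnW/subnKC <-; elim: (N - m)%N => [|d [j jE]].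
  by exists 0%N; rewrite addn0 expn0.
have M0 : (0 < 2 ^ (m + d))%N by rewrite expn_gt0.
rewrite addnS expnSr; case: (eq_mod_double M0 jE) => aE; first by exists j.
have [k kE] := exp_1add2 d m2.
(* The factor [(1 + 2^m)^(2^d)] is 1 plus an odd multiple of [2^(m+d)]; multiplying an odd number by
   it adds exactly [2^(m+d)] modulo [2^(m+d+1)]. *)
exists (j + 2 ^ d)%N; rewrite aE (expnD _ j) kE.
set M := (2 ^ (m + d))%N; set c := ((1 + 2 ^ m) ^ j)%N.
have c_odd : odd c by rewrite oddX oddD oddX; case: (m) m2 => //= ? _;
  rewrite orbT.
have -> : c = (c./2 * 2 + 1)%N by rewrite muln2 addn1 -[LHS]odd_double_half
  c_odd.
rewrite -[LHS](modnMDl (c./2 + c./2 * k.*2 + k)); congr (_ %% _)%N.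
rewrite -muln2; ring.
Qed.

(* e = 1 when n >= 2, and e = -1 when n = 1. *)
Lemma exp_sign_gen n N : (1 <= n)%N -> (2 <= N)%N -> exists e,
  [/\ (e = 1 %[mod 2 ^ n])%N, (e * e = 1 %[mod 2 ^ N])%N
    & forall a, (a = 1 %[mod 2 ^ n])%N ->
      exists i j, (a = e ^ i * (1 + 2 ^ maxn n 2) ^ j %[mod 2 ^ N])%N].
Proof.
move=> n1 N2; have [n2|] := leqP 2 n.
  exists 1%N; split=> // a a1; have [j aE] := exp_1add2_gen N n2 a1.
  by exists 0%N, j; rewrite mul1n.
rewrite ltnS => n_le1; have -> : n = 1%N by apply/eqP; rewrite eqn_leq n_le1.
have N0 : (0 < 2 ^ N)%N by rewrite expn_gt0.
have NE : (2 ^ N = 4 * 2 ^ (N - 2))%N by rewrite -(expnD 2 2) subnKC.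
set e := (2 ^ N).-1; have eE : (2 ^ N = e + 1)%N by rewrite addn1 prednK.
have ee1 : (e * e = 1 %[mod 2 ^ N])%N.
  have : (e * e + 2 ^ N = 1 + e * 2 ^ N)%N by rewrite eE; ring.
  by move/(congr1 (modn^~ (2 ^ N)%N)); rewrite modnDr addnC modnMDl.
exists e; split=> // [|a a1]; first by rewrite expn1; move: NE eE; lia.
(* As [e] is -1 modulo [2^N], this says that the odd number [a] or its negative is 1 modulo 4, hence
   a power of 5. *)
rewrite expn1 in a1;
  have [a4|a4] : (a = 1 %[mod 4])%N \/ (e * a = 1 %[mod 4])%N.
- have [|] : (a %% 4 = 1 \/ a %% 4 = 3)%N by lia.
    by left.
  move=> a3; right; rewrite -modnMm a3.
  by have -> : (e %% 4 = 3)%N by lia.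
- have [j aE] := exp_1add2_gen N (leqnn 2) a4.
  by exists 0%N, j; rewrite mul1n.
have [j aE] := exp_1add2_gen N (leqnn 2) a4.
exists 1%N, j; rewrite expn1 -modnMmr -aE modnMmr mulnA -modnMml ee1 modnMml.
by rewrite mul1n.
Qed.

End PowersOfTwo.

(** * Bounding the order of an element in a quotient by [dgroup] *)

Section QuotientBound.
Import GroupScope.
Variables (gT : finGroupType) (G H : {group gT}) (a b : gT) (N : nat).
Hypotheses (nHG : H <| G) (Ga : a \in G) (Gb : b \in G).
Hypotheses (aa : a * a \in H) (bN : b ^+ (2 ^ N)%N \in H) (ab : [~ a, b] \in H).
Hypothesis genG : forall x, x \in G -> exists i j, x \in a ^+ i * b ^+ j *: H.

(** The images [A] and [B] generate [G / H], with [A^2 = 1] and [B] of order [2^s]. The quotient is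
    cyclic of order [2^s] when [A] lies in [<[B]>], and [Z/2 x Z/2^s] otherwise; both shapes count
    in [dgroup], so [s <= dgroup G]. *)
Lemma dgroup_gen : b ^+ (2 ^ dgroup G)%N \in H.
Proof.
have sGN : G \subset 'N(H) := normal_norm nHG.
have Na := subsetP sGN _ Ga; have Nb := subsetP sGN _ Gb.
set A := coset H a; set B := coset H b.
have QE : G / H = <[A]> * <[B]>.
  apply/eqP; rewrite eqEsubset; apply/andP; split.
    apply/subsetP => _ /morphimP[x _ /genG[i [j /lcosetP[h Hh ->]]] ->].
    have Nh := subsetP (normG H) _ Hh.
    rewrite /= !morphM ?groupM ?groupX // !morphX //= (coset_id Hh) mulg1.
    by rewrite mem_mulg ?mem_cycle.
  by rewrite mul_subG ?cycle_subG ?mem_quotient.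
have cAB : commute A B.
  by apply/commgP; rewrite -morphR //= coset_id.
have A2 : (#[A] %| 2)%N by rewrite order_dvdn expgS expg1 -morphM //= coset_id.
have : (#[B] %| 2 ^ N)%N by rewrite order_dvdn -morphX //= coset_id.
case/(dvdn_pfactor _ _ (isT : prime 2)) => s _ Bs.
suff [k le_sk hk] : exists2 k, (s <= k)%N & has_2quotient G k.
  have /dvdn_exp2l dv := leq_trans le_sk (leq_dgroup hk).
  apply: coset_idr; rewrite ?groupX // morphX //=; apply/eqP.
  by rewrite -order_dvdn Bs dv.
have isoB : G / H = <[B]> -> has_2quotient G s.
  move=> QB; apply/existsP; exists H; rewrite nHG /= QB -Bs isog_sym.
  by rewrite Zp_isog.
have [AB|nAB] := boolP (A \in <[B]>).
  by exists s => //; apply: isoB; rewrite QE mulSGid ?cycle_subG.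
have oA : #[A] = 2%N.
  move: A2; rewrite (dvdn_divisors _ (isT : 0 < 2)%N) !inE => /orP[] /eqP // A1.
  by move: nAB; rewrite (eqP (etrans (esym (order_eq1 A)) _)) ?group1 // A1.
(* The index is [s.+1] because the second shape is [Z/2 x Z/2^(k-1)]. *)
exists s.+1 => //; apply/existsP; exists H; rewrite nHG /=; apply/orP; right.
have tiAB : <[A]> :&: <[B]> = 1.
  by apply: prime_TIg; rewrite ?cycle_subG // -orderE oA.
have defQ : <[A]> \x <[B]> = G / H.
  rewrite QE dprodE // cycle_subG /= cent_cycle; apply/cent1P;
    exact: commute_sym.
have isoA : Zp 2 \isog <[A]> by rewrite -oA Zp_isog.
have isoZB : Zp (2 ^ s)%N \isog <[B]> by rewrite -Bs Zp_isog.
rewrite isog_sym.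
apply: (isog_dprod (setX_dprod [group of Zp 2] [group of Zp (2 ^ s)%N]) defQ).
  by apply: isog_trans isoA; rewrite isog_sym isog_setX1.
by apply: isog_trans isoZB; rewrite isog_sym isog_set1X.
Qed.

End QuotientBound.

(** * Galois elements as exponents on roots of unity *)

Section GaloisExponents.
Variables (n N : nat) (p : laurent algC).
Hypotheses (le_nN : (n <= N)%N) (p0 : p != 0).
Hypothesis Kp : laurent_over (Qzeta2 n) p.

Local Notation z := (zeta (2 ^ n)).
Local Notation w := (zeta (2 ^ N)).
Local Notation M := (dp_model z p).
Local Notation K := (dp_base z p).
Local Notation E := (dp_split z p).
Local Notation emb := (nf_emb M).

Let prim_z : (2 ^ n)%N.-primitive_root z := zeta2_prim n.
Let prim_w : (2 ^ N)%N.-primitive_root w := zeta2_prim N.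

Let zN : z ^+ (2 ^ N) = 1.
Proof.
by rewrite -(subnKC le_nN) expnD exprM (prim_expr_order prim_z) expr1n.
Qed.

Let sKE : (K <= E)%VS.
Proof. by have /and3P[] := dp_galois p0 Kp. Qed.

(* s is induced by zeta |-> zeta^t; this is expressed on the elements of E lying
   in Q(zeta), since zeta = zeta (2 ^ N) itself need not belong to the model. *)
Definition acts_by (s : gal_of E) (t : nat) := forall y r (a : {poly rat}),
  y \in E -> emb y = a.[@ w ^+ r] -> emb (s y) = a.[@ w ^+ (r * t)].

(** [s] extends to an endomorphism [nu] of [algC], which sends [w] to some [w^t]. As [nu] fixes [z],
    a power of [w], it follows that [z^t = z]. *)
Lemma gal_acts_by s : s \in 'Gal(E / K)%g ->
  exists2 t, (t = 1 %[mod 2 ^ n])%N & acts_by s t.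
Proof.
move=> Gs; have [nu nuE] := extend_algC_subfield_aut emb (gal_repr s).
have nu_w : nu w ^+ (2 ^ N) = 1.
  by rewrite -rmorphXn (prim_expr_order prim_w) rmorph1.
have [t tE] := prim_rootP prim_w nu_w.
have [j jE] := prim_rootP prim_w zN.
exists t => [|y r a _ yE];
  last by rewrite nuE yE horner_aut rmorphXn tE -exprM mulnC.
have [z1E _] := dp_gens z p.
have /= := nuE (head 0 (nf_gens M)).
rewrite (fixed_gal sKE Gs (memv_adjoin _ _)) z1E => nuz.
apply/eqP; rewrite -(eq_prim_root_expr prim_z) expr1.
by apply/eqP; rewrite [RHS]nuz jE rmorphXn /= tE exprAC.
Qed.

(** Conversely, an endomorphism of [algC] raising the [2^N]-th roots of unity to the power [t]
    restricts to the normal field [M], fixes [K] because [t] is 1 modulo [2^n], and so induces an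
    element of the Galois group. *)
Lemma acts_by_gal t : coprime t (2 ^ N) -> (t = 1 %[mod 2 ^ n])%N ->
  exists2 s, s \in 'Gal(E / K)%g & acts_by s t.
Proof.
move=> co_t t1; have [u uE] := Qn_aut_exists co_t.
have [u0 u0E] := restrict_aut_to_normal_num_field emb u.
have uz : u z = z.
  rewrite uE //; apply/eqP; rewrite -[X in _ == X]expr1.
  by rewrite (eq_prim_root_expr prim_z) t1.
have homu : kHom K E (linfun u0).
  apply/kHomP_tmp; split=> [x Kx|x y _ _]; last by rewrite !lfunE rmorphM.
  have /QadjP[a aE] : Qadj z (emb x) by apply/dp_baseP; exists x.
  by apply: (fmorph_inj emb); rewrite lfunE /= u0E aE horner_aut uz.
have sKEE : (K <= E <= E)%VS by rewrite sKE subvv.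
have nKE : normalField K E by have /and3P[] := dp_galois p0 Kp.
have [s Gs sE] := kHom_to_gal sKEE nKE homu.
exists s => // y r a Ey yE; rewrite -sE // lfunE /= u0E yE horner_aut.
rewrite uE; first by rewrite -exprM.
by rewrite exprAC (prim_expr_order prim_w) expr1n.
Qed.

Lemma acts_byM s1 s2 t1 t2 : acts_by s1 t1 -> acts_by s2 t2 ->
  acts_by (s1 * s2)%g (t1 * t2).
Proof.
move=> st1 st2 y r a Ey yE; rewrite galM // mulnA.
by apply: st2; rewrite ?memv_gal //; apply: st1.
Qed.

Lemma acts_by1 : acts_by 1%g 1.
Proof. by move=> y r a Ey yE; rewrite gal_id muln1. Qed.

Lemma acts_byX s t i : acts_by s t -> acts_by (s ^+ i)%g (t ^ i).
Proof.
move=> st; elim: i => [|i IH]; first exact: acts_by1.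
by rewrite expgS expnS; apply: acts_byM.
Qed.

Lemma acts_by_eq s1 s2 t1 t2 y : acts_by s1 t1 -> acts_by s2 t2 ->
  y \in E -> Qzeta2 N (emb y) -> (t1 = t2 %[mod 2 ^ N])%N -> s1 y = s2 y.
Proof.
move=> st1 st2 Ey /QadjP[a yE] t12; apply: (fmorph_inj emb).
have yE1 : emb y = a.[@ w ^+ 1] by rewrite expr1.
rewrite (st1 _ _ _ Ey yE1) (st2 _ _ _ Ey yE1) !mul1n.
congr _.[_]; apply/eqP; rewrite (eq_prim_root_expr prim_w); exact/eqP.
Qed.

End GaloisExponents.

Lemma iter_horner_aut (u : {rmorphism algC -> algC}) N e k v (a : {poly rat}) :
    (forall x, x ^+ (2 ^ N) = 1 -> u x = x ^+ e) -> v ^+ (2 ^ N) = 1 ->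
  iter k u a.[@ v] = a.[@ v ^+ (e ^ k)].
Proof.
move=> uE v1; elim: k => [|k IH] /=; first by rewrite expn0 expr1.
rewrite IH horner_aut uE ?expnS; first by rewrite mulnC exprM.
by rewrite exprAC v1 expr1n.
Qed.

(* Each step down is x = b + zeta c with b, c in the smaller field, where some
   power of u fixes b and c and sends zeta to - zeta. *)
Lemma Qzeta2_descent (u : {rmorphism algC -> algC}) m d N x : (2 <= m)%N ->
    (forall v, v ^+ (2 ^ N) = 1 -> u v = v ^+ ((1 + 2 ^ m) ^ (2 ^ d))) ->
  u x = x -> Qzeta2 N x -> Qzeta2 (m + d) x.
Proof.
move=> m2; elim: N => [|N IH] uE ux xN; first exact: Qzeta2_mono xN.
have [le_N|] := leqP N.+1 (m + d); first exact: Qzeta2_mono xN.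
rewrite ltnS => le_mdN; apply: IH => //.
  by move=> v vN; apply: uE; rewrite expnSr exprM vN expr1n.
have prim_w := zeta2_prim N.+1; set w := zeta (2 ^ N.+1) in prim_w.
case/QadjP: xN => a xE; rewrite -/w in xE.
have w1 := prim_expr_order prim_w.
have wN : w ^+ (2 ^ N) = -1.
  have : (w ^+ (2 ^ N)) ^+ 2 == 1 by rewrite -exprM -expnSr w1.
  rewrite sqrf_eq1 -(prim_order_dvd prim_w) => /orP[/dvdn_leq|/eqP //].
  by rewrite expn_gt0 leq_exp2l // ltnn => /(_ isT).
(* The [2^(N-m-d)]-th iterate of [u] raises [w] to the power
   [(1 + 2^m)^(2^(N-m)) = 1 + 2^N (2k + 1)], so it maps [w] to [-w] while fixing [x]. *)
have [k kE] := exp_1add2 (N - m) m2.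
have xN : a.[@ - w] = x.
  have := iter_horner_aut (2 ^ (N - m - d)) a uE w1.
  rewrite -expnM -expnD (_ : (d + (N - m - d) = N - m)%N); last by lia.
  rewrite kE subnKC; last by lia.
  rewrite exprD expr1 exprM wN -signr_odd /= odd_double /= expr1 mulrN1 => <-.
  by rewrite -xE; elim: (2 ^ _)%N => //= i ->.
rewrite xE in xN *.
have evodd v : a.[@ v] = (even_poly a).[@ v ^+ 2] + (odd_poly a).[@ v ^+ 2] * v.
  rewrite -{1}[a]poly_even_odd rmorphD rmorphM /= !map_comp_poly map_polyX.
  by rewrite map_polyXn hornerD hornerM !horner_comp hornerX hornerXn.
have odd0 : (odd_poly a).[@ w ^+ 2] * w = 0.
  move: xN; rewrite !evodd sqrrN mulrN => /addrI/eqP.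
  by rewrite eq_sym -addr_eq0 -mulr2n mulrn_eq0 /= => /eqP.
rewrite evodd odd0 addr0; apply: Qadj_horner; apply: Qzeta2_root.
by rewrite -exprM -expnS.
Qed.

(** The Galois group acts on [y] through exponents modulo [2^N], so the stabilizer of [y] is normal
    and [dgroup_gen] applies to lifts of [e] and [1 + 2^m]. *)
Lemma dp_split_cyclotomic n p N y : (1 <= n)%N -> p != 0 ->
    laurent_over (Qzeta2 n) p -> let z := zeta (2 ^ n) in
    y \in dp_split z p -> Qzeta2 N (nf_emb (dp_model z p) y) ->
  Qzeta2 (n + dpoly z p + 1) (nf_emb (dp_model z p) y).
Proof.
move=> n1 p0 Kp z Ey; set x := nf_emb _ y => xN.
(* For [n = 1] the relevant residues are generated by -1 and 5, whence [m = 2]. Enlarging [N] up to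
   [m] only weakens the assumption on [x]. *)
set m := maxn n 2; wlog N_ge : N xN / (m <= N)%N.
  move=> th; apply: (th (maxn N m)); rewrite ?leq_maxr //.
  by apply: Qzeta2_mono xN; rewrite leq_maxl.
have m2 : (2 <= m)%N by rewrite leq_maxr.
have le_nN : (n <= N)%N by apply: leq_trans N_ge; rewrite leq_maxl.
have [e [e1 ee gen_e]] := exp_sign_gen n1 (leq_trans m2 N_ge).
rewrite -/m in gen_e; set c := (1 + 2 ^ m)%N in gen_e.
have N0 : (0 < N)%N by apply: leq_trans N_ge; apply: leq_trans m2.
have co_c i : coprime (c ^ i) (2 ^ N).
  rewrite coprimeXl // coprimeXr // coprimen2 oddD oddX.
  by case: (m) m2.
have co_e : coprime e (2 ^ N).
  have : coprime (e * e) (2 ^ N) by rewrite -coprime_modl ee coprime_modl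
    coprime1n.
  by rewrite coprimeMl => /andP[].
have c1 : (c = 1 %[mod 2 ^ n])%N.
  by rewrite /c /m -(subnKC (leq_maxl n 2)) expnD mulnC addnC modnMDl.
have [sa Ga saE] := acts_by_gal le_nN p0 Kp co_e e1.
have [sb Gb sbE] := acts_by_gal le_nN p0 Kp (co_c 1%N)
  (etrans (congr1 (modn^~ _) (expn1 c)) c1).
rewrite expn1 in sbE.
set E := dp_split z p in Ey sa Ga saE sb Gb sbE *.
set G := ('Gal(E / dp_base z p))%G.
have eqy s1 s2 t1 t2 : acts_by N s1 t1 -> acts_by N s2 t2 ->
    (t1 = t2 %[mod 2 ^ N])%N -> s1 y = s2 y.
  by move=> st1 st2; apply: (acts_by_eq st1 st2 Ey xN).
(* Exponents commute under multiplication; this gives the normality of [H] and the condition on the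
   commutator. *)
have comm_y s1 s2 : s1 \in G -> s2 \in G -> s1 (s2 y) = s2 (s1 y).
  move=> /(gal_acts_by le_nN p0 Kp)[t1 _ st1]
    /(gal_acts_by le_nN p0 Kp)[t2 _ st2].
  rewrite -!galM //; apply: (eqy _ _ _ _ (acts_byM st2 st1) (acts_byM st1 st2)).
  by rewrite mulnC.
pose H := [set s in G | s y == y].
have HP s : reflect (s \in G /\ s y = y) (s \in H).
  by rewrite inE; apply: (iffP andP) => -[? /eqP].
have gH : group_set H.
  apply/group_setP; split; first by apply/HP; rewrite group1 gal_id.
  move=> s1 s2 /HP[G1 y1] /HP[G2 y2]; apply/HP.
  by rewrite groupM // galM // y1.
pose HG := Group gH.
have nHG : (HG <| G)%g.
  apply/andP; split; first by apply/subsetP => s /HP[].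
  apply/subsetP => s Gs; rewrite inE;
    apply/subsetP => _ /imsetP[h /HP[Gh hy] ->].
  apply/HP; split; first by rewrite groupJ.
  rewrite conjgE galM // galM ?memv_gal // comm_y ?groupV // hy.
  by rewrite -galM // mulVg gal_id.
have aaH : (sa * sa)%g \in HG.
  apply/HP; split; first by rewrite groupM.
  by rewrite (eqy _ _ _ _ (acts_byM saE saE) (@acts_by1 n N p) ee) gal_id.
have bNH : (sb ^+ (2 ^ N))%g \in HG.
  apply/HP; split; first by rewrite groupX.
  have c2N : (c ^ (2 ^ N) = 1 %[mod 2 ^ N])%N.
    have [k ->] := exp_1add2 N m2.
    by rewrite expnD mulnC mulnA addnC modnMDl.
  by rewrite (eqy _ _ _ _ (acts_byX _ sbE) (@acts_by1 n N p) c2N) gal_id.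
have yV s s' : s \in G -> s' \in G -> s y = s' y -> (s^-1 * s')%g y = y.
  move=> Gs Gs' ss'; rewrite galM // comm_y ?groupV // -ss' -galM //.
  by rewrite mulgV gal_id.
have abH : [~ sa, sb]%g \in HG.
  apply/HP; split; first by rewrite groupR.
  rewrite commgEl conjgE mulgA -invMg; apply: yV; rewrite ?groupM //.
  by rewrite !galM // comm_y.
have genG s : s \in G -> exists i j, s \in ((sa ^+ i * sb ^+ j) *: HG)%g.
  move=> Gs; have [t t1 st] := gal_acts_by le_nN p0 Kp Gs.
  have [i [j tE]] := gen_e t t1; exists i, j; rewrite mem_lcoset.
  have Gab : (sa ^+ i * sb ^+ j)%g \in G by rewrite groupM ?groupX.
  apply/HP; split; first by rewrite groupM ?groupV.
  apply: yV => //; apply/esym/(eqy _ _ _ _ st _ tE).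
  exact: acts_byM (acts_byX _ saE) (acts_byX _ sbE).
have /HP[_ by_y] := dgroup_gen nHG Ga Gb aaH bNH abH genG.
(* [u] acts on [x] as [sb ^+ (2 ^ dpoly z p)] acts on [y], hence fixes it, and [Qzeta2_descent]
   reaches level [m + dpoly z p]. *)
have [u uE] := Qn_aut_exists (co_c (2 ^ dpoly z p)%N).
(* Here [m <= n + 1], with equality only for [n = 1]: this is the source of the [+ 1] in the
   level. *)
have le_m : (m + dpoly z p <= n + dpoly z p + 1)%N.
  by rewrite addnAC leq_add2r /m geq_max leq_addr addn1 ltnS n1.
apply: (Qzeta2_mono le_m); apply: (Qzeta2_descent m2 uE _ xN).
case/QadjP: (xN) => a xE;
  rewrite {1}xE horner_aut uE ?(prim_expr_order (zeta2_prim N)) //.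
have xE1 : x = a.[@ zeta (2 ^ N) ^+ 1] by rewrite expr1.
have := acts_byX (2 ^ dpoly z p) sbE Ey xE1.
by rewrite mul1n by_y.
Qed.

(** * Norms *)

Lemma Qzeta2_image m : field_image (Qzeta2 m).
Proof. by have [E [iota [imE _]]] := Qadj_field (zeta (2 ^ m));
  exists E, iota. Qed.

Lemma Qzeta2_subfieldC m : subfieldC (Qzeta2 m).
Proof. exact/field_image_subfieldC/Qzeta2_image. Qed.

Lemma Qzeta2oo_subfieldC : subfieldC Qzeta2oo.
Proof.
have up x y : Qzeta2oo x -> Qzeta2oo y -> exists m, Qzeta2 m x /\ Qzeta2 m y.
  case=> [i xi] [j yj]; exists (maxn i j).
  by split; [apply: Qzeta2_mono xi; apply: leq_maxl|apply: Qzeta2_mono yj;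
    apply: leq_maxr].
split.
- by exists 0%N; apply: (subfieldC1 (Qzeta2_subfieldC 0)).
- move=> x y xoo yoo; have [m [xm ym]] := up x y xoo yoo.
  by exists m; apply: (subfieldCB (Qzeta2_subfieldC m)).
- move=> x y xoo yoo; have [m [xm ym]] := up x y xoo yoo.
  by exists m; apply: (subfieldCM (Qzeta2_subfieldC m)).
by move=> x [m xm]; exists m; apply: (subfieldCV (Qzeta2_subfieldC m)).
Qed.

Lemma lover_Qzeta2oo g : laurent_over Qzeta2oo g ->
  exists m, laurent_over (Qzeta2 m) g.
Proof.
move=> goo; suff [m gm] : exists m, forall j, j \in (msupp g : seq int) ->
  Qzeta2 m g@_j.
  exists m => j; have [/gm//|/mcoeff_outdom ->] := boolP (j \in msupp g).
  exact: (subfieldC0 (Qzeta2_subfieldC m)).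
elim: (msupp g : seq int) => [|j s [m sm]]; first by exists 0%N.
have [i ji] := goo j; exists (maxn i m) => l; rewrite inE => /orP[/eqP ->|/sm].
  by apply: Qzeta2_mono ji; apply: leq_maxl.
by apply: Qzeta2_mono; apply: leq_maxr.
Qed.

Lemma lover_sub (F F' : algC -> Prop) g : (forall x, F x -> F' x) ->
  laurent_over F g -> laurent_over F' g.
Proof. by move=> sFF' Fg j; apply: sFF'. Qed.

Lemma lunit_sub (F F' : algC -> Prop) u : (forall x, F x -> F' x) ->
  lunit F u -> lunit F' u.
Proof.
move=> sFF' [Fu [v Fv uv]]; split; first exact: lover_sub Fu.
by exists v => //; apply: lover_sub Fv.
Qed.

Lemma lassociate_sub (F F' : algC -> Prop) g h : (forall x, F x -> F' x) ->
  lassociate F g h -> lassociate F' g h.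
Proof. by move=> sFF' [u Uu ->]; exists u => //; apply: lunit_sub Uu. Qed.

Lemma lnorm_sub (F F' : algC -> Prop) g : (forall x, F x -> F' x) ->
  lnorm F g -> lnorm F' g.
Proof.
move=> sFF' [u [h [Uu Fh ->]]]; exists u, h.
by split=> //; [apply: lunit_sub Uu|apply: lover_sub Fh].
Qed.

Section Norms.
Variable F : algC -> Prop.
Hypothesis sF : subfieldC F.
Implicit Types f g u : laurent algC.

Lemma lnorm_lassociate f g : laurent_over F g -> lassociate F f (g * lbar g) ->
  lnorm F f.
Proof. by move=> Fg [u Uu ->]; exists u, g; rewrite mulrA. Qed.

Lemma lnorm_unit u : lunit F u -> lnorm F u.
Proof.
by move=> Uu; exists u, 1; rewrite lbar1 !mulr1; split=> //; apply: lover1.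
Qed.

Lemma lnormM f g : lnorm F f -> lnorm F g -> lnorm F (f * g).
Proof.
move=> [u [h [Uu Fh ->]]] [v [l [Uv Fl ->]]].
exists (u * v), (h * l); split; [exact: lunitM|exact: loverM|].
by rewrite lbarM (mulrACA (u * h)) (mulrACA u).
Qed.

Lemma lnorm_prod (I : Type) (s : seq I) (P : pred I) (G : I -> laurent algC) :
  (forall i, P i -> lnorm F (G i)) -> lnorm F (\prod_(i <- s | P i) G i).
Proof.
move=> nG; elim/big_rec: _ => [|i x /nG Gi nx]; last exact: lnormM.
exact/lnorm_unit/lunit1.
Qed.

Lemma lunitX u n : lunit F u -> lunit F (u ^+ n).
Proof.
move=> Uu; elim: n => [|n IH]; first exact: lunit1.
by rewrite exprS; apply: lunitM.
Qed.

Lemma lassociateM f f' g g' : lassociate F f f' -> lassociate F g g' ->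
  lassociate F (f * g) (f' * g').
Proof.
move=> [u Uu ->] [v Uv ->]; exists (u * v); first exact: lunitM.
by rewrite mulrACA.
Qed.

Lemma lassociateX f g n : lassociate F f g -> lassociate F (f ^+ n) (g ^+ n).
Proof. by move=> [u Uu ->]; exists (u ^+ n);
  [apply: lunitX|rewrite exprMn]. Qed.

Lemma lassociate_refl g : lassociate F g g.
Proof. by exists 1; [apply: lunit1|rewrite mul1r]. Qed.

Lemma lassociate_lbar f g : (forall x, F x -> F x^*) ->
  lassociate F f g -> lassociate F (lbar f) (lbar g).
Proof.
move=> Fconj [u [Fu [v Fv uv]] ->]; exists (lbar u); last by rewrite lbarM.
have Fbar h : laurent_over F h -> laurent_over F (lbar h).
  by move=> Fh j; rewrite mcoeff_lbar; apply: Fconj.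
by split; [apply: Fbar|exists (lbar v); [apply: Fbar|rewrite -lbarM uv lbar1]].
Qed.

End Norms.

(** * Self-conjugate irreducible factors as norms *)

Lemma poly_over_roots_dp (z : algC) (p : laurent algC) (s : seq algC) i :
    p != 0 -> (forall r, r \in s -> root (lpoly p) r) ->
  exists2 y, y \in dp_split z p &
    nf_emb (dp_model z p) y = (\prod_(r <- s) ('X - r%:P))`_i.
Proof.
move=> p0 sp; have [_ rootsE] := dp_gens z p.
have in_split r : r \in s ->
  exists2 y, y \in dp_split z p & nf_emb (dp_model z p) y = r.
  move=> /sp rp.
  have : r \in map (nf_emb (dp_model z p)) (behead (nf_gens (dp_model z p))).
    rewrite rootsE; have := svalP (closed_field_poly_normal (lpoly p)).
    rewrite -/(lroots p) => pE.
    by move: rp; rewrite pE rootZ ?root_prod_XsubC // lead_coef_eq0 lpoly_eq0.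
  by case/mapP => y sy ->; exists y => //; apply: seqv_sub_adjoin.
have [Q QE sQ] : exists2 Q,
    map_poly (nf_emb (dp_model z p)) Q = \prod_(r <- s) ('X - r%:P)
    & Q \is a polyOver (dp_split z p).
  elim: s in_split {sp} => [|r s IH] in_split.
    by exists 1; rewrite ?big_nil ?rmorph1 ?rpred1.
  have [|Q QE sQ] := IH; first by move=> r' sr'; apply: in_split;
    rewrite inE sr' orbT.
  have [|y sy yr] := in_split r; first by rewrite inE eqxx.
  exists (('X - y%:P) * Q); last by rewrite rpredM // polyOverXsubC.
  by rewrite big_cons rmorphM /= map_polyXsubC QE yr.
by exists Q`_i; [apply: (polyOverP sQ)|rewrite -QE coef_map].
Qed.

(** At a simple root [r] of [P], dividing by the inner gcd lowers the multiplicity in [G] by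
    [min(m, mup r G)], so [r] survives exactly when [m < mup r G]. The outer gcd caps the
    multiplicity at 1 and discards the other roots. *)
Lemma mup_gcdp_exp (F : fieldType) (P G : {poly F}) m r :
    P != 0 -> G != 0 -> (mup r P <= 1)%N ->
  let H := gcdp P (G %/ gcdp G (P ^+ m)) in
  mup r H = ((0 < mup r P) && (m < mup r G))%N.
Proof.
move=> P0 G0 le1 /=; set D := gcdp G (P ^+ m); set H := gcdp P _.
have D0 : D != 0 by rewrite gcdp_eq0 negb_and G0.
have GD : G %/ D * D = G by rewrite divpK // dvdp_gcdl.
have GD0 : G %/ D != 0 by apply: contra_neq G0 => E; have := GD;
  rewrite E mul0r => /esym.
have H0 : H != 0 by rewrite gcdp_eq0 negb_and P0.
have mupG : (mup r (G %/ D) + mup r D = mup r G)%N by rewrite -mupM // GD.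
(* Multiplicities in a gcd are minima; stated through thresholds [k] they suit [lia], and the values
   of [k] taken below determine them. *)
have mupH k : (k <= mup r H)%N = (k <= mup r P)%N && (k <= mup r (G %/ D))%N.
  by rewrite !mup_geq // dvdp_gcd.
have mupD k : (k <= mup r D)%N = (k <= mup r G)%N && (k <= m * mup r P)%N.
  have -> : (m * mup r P)%N = mup r (P ^+ m).
    elim: (m) => [|l IH]; first by rewrite expr0 (@mupNroot _ _ 1) ?root1.
    by rewrite exprS mupM ?expf_neq0 // -IH mulSn.
  by rewrite !mup_geq ?expf_neq0 // dvdp_gcd.
have := mupH 1%N; have := mupH 2%N; have := mupD m; have := mupD m.+1;
  have := mupD (mup r D).
have := mupD (mup r G).
case: (mup r P) le1 => [|[|//]] _; rewrite ?muln0 ?muln1.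
  by lia.
lia.
Qed.

(** Two numbers above [m] sum to at least [2m + 2], and two numbers at most [m] to at most [2m]. *)
Lemma ltn_half_add a b m :
  (a + b = m.*2.+1)%N -> ((m < a) + (m < b) = 1)%N.
Proof. by case: (ltnP m a); case: (ltnP m b) => /=; lia. Qed.

(** Supplies the norm in case (2): [p] is an associate of [h * lbar h], where [h] takes one root
    from each pair [r], [recip_conj r] of roots of [p]. *)
Lemma norm_factor n p g N m : (1 <= n <= N)%N ->
    lirreducible (Qzeta2 n) p -> lassociate (Qzeta2 n) (lbar p) p ->
    laurent_over (Qzeta2 N) g -> g != 0 ->
    (forall r, r != 0 -> (0 < lmu r p)%N ->
      (lmu r g + lmu (recip_conj r) g)%N = m.*2.+1) ->
  lnorm (Qzeta2 (n + dpoly (zeta (2 ^ n)) p + 1)) p.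
Proof.
move=> /andP[n1 le_nN] irrp barp Ng g0 gE; have [Kp p0 _ _] := irrp.
set l := (n + _ + 1)%N; set z := zeta (2 ^ n) in l *.
have sK := Qzeta2_subfieldC n; have sN := Qzeta2_subfieldC N.
have sl := Qzeta2_subfieldC l.
have P0 : lpoly p != 0 by rewrite lpoly_eq0.
have G0 : lpoly g != 0 by rewrite lpoly_eq0.
have Np : poly_over (Qzeta2 N) (lpoly p).
  by move=> i; apply: Qzeta2_mono le_nN _; apply: (lover_lpoly sK).
have NG : poly_over (Qzeta2 N) (lpoly g) by move=> i; apply: (lover_lpoly sN).
have imN := Qzeta2_image N.
(* The roots of H0 are the roots of p of multiplicity at least m + 1 in g; for
   each root r of p this holds of exactly one of r and recip_conj r. *)
pose H0 := gcdp (lpoly p) (lpoly g %/ gcdp (lpoly g) (lpoly p ^+ m)).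
have NH0 : poly_over (Qzeta2 N) H0.
  apply: (poly_over_gcdp imN) => //; apply: (poly_over_divp imN) => //.
  by apply: (poly_over_gcdp imN) => //; apply: (poly_over_exp imN).
have H00 : H0 != 0 by rewrite gcdp_eq0 negb_and P0.
have [s H0E] := closed_field_poly_normal H0.
(* Being monic, [H] has coefficients that are polynomials in the chosen roots of [p]; they also stay
   in [Qzeta2 N], since [H] is [H0] over its leading coefficient. *)
set H := \prod_(r <- s) ('X - r%:P) in H0E.
have lc0 : lead_coef H0 != 0 by rewrite lead_coef_eq0.
have HE : H = (lead_coef H0)^-1 *: H0 by rewrite {2}H0E scalerA mulVf //
  scale1r.
have H_neq0 : H != 0 by rewrite monic_neq0 // monic_prod_XsubC.
have NH i : Qzeta2 N H`_i.
  rewrite HE coefZ; apply: (subfieldCM sN) => //.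
  by apply: (subfieldCV sN); apply: NH0.
(* The coefficients of H lie in Qzeta2 N and in the splitting field of p. *)
have lH : poly_over (Qzeta2 l) H.
  move=> i; have [r rs|y sy yE] := @poly_over_roots_dp z p s i p0.
    have : root H0 r by rewrite H0E rootZ // root_prod_XsubC.
    by rewrite root_gcd => /andP[].
  rewrite -/H in yE; rewrite -yE; apply: (@dp_split_cyclotomic n p N) => //.
  by rewrite yE.
pose h := lofpoly H.
have lh : laurent_over (Qzeta2 l) h by apply/(lover_lofpoly sl).
have h0 : h != 0 by rewrite lofpoly_eq0.
have mu_h r : r != 0 -> lmu r h = ((0 < lmu r p) && (m < lmu r g))%N.
  move=> r0; rewrite -[h]mul1r -lmon10 lmu_poly ?oner_eq0 //.
  have -> : mup r H = mup r H0.
    rewrite [in RHS]H0E -mul_polyC mupMr //.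
    by rewrite rootC.
  apply: mup_gcdp_exp => //.
  exact: (irreducible_lmu_le1 (Qzeta2_image n) irrp).
have mu_bar r : r != 0 -> lmu (recip_conj r) p = lmu r p.
  by move=> r0; rewrite -lmu_bar // (lassociate_lmu r0 p0 barp).
have lbarh : laurent_over (Qzeta2 l) (lbar h).
  by move=> j; rewrite mcoeff_lbar; apply: Qzeta2_conj.
apply: (lnorm_lassociate lh); apply: (lmu_lassociate sl) => //.
- by apply: lover_sub Kp => x; apply: Qzeta2_mono; rewrite /l -addnA leq_addr.
- exact: (loverM sl).
- by rewrite lmul_eq0 lbar_eq0 orbb.
(* At a root of [p] the contributions of [h] and [lbar h] add up to 1; elsewhere both vanish. *)
move=> r r0; rewrite lmuM ?lbar_eq0 // lmu_bar // !mu_h ?recip_conj_eq0 //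
  mu_bar //.
have := gE r r0; have := irreducible_lmu_le1 (Qzeta2_image n) irrp r0.
case: (lmu r p) => [|[|//]] /= _; first by rewrite addn0.
by move=> /(_ isT)/ltn_half_add.
Qed.

(* Pairing the factors and the equivalence *)
Opaque lmu.

Lemma lnorm_pairing (F : algC -> Prop) (k : nat) (s : 'I_k -> 'I_k)
    (G : 'I_k -> laurent algC) :
    subfieldC F -> involutive s ->
    (forall i, s i = i -> lnorm F (G i)) ->
    (forall i, s i != i -> lnorm F (G i * G (s i))) ->
  lnorm F (\prod_i G i).
Proof.
move=> sF sK fixG pairG; rewrite (bigID (fun i => s i == i)) /=.
apply: (lnormM sF); first by apply: (lnorm_prod sF) => i /eqP/fixG.
(* Each two-element orbit of [s] is represented by its smaller index; reindexing by [s] brings the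
   factor at the larger one there. *)
rewrite (bigID (fun i : 'I_k => (i < s i)%N)) /=.
rewrite [X in _ * X](reindex_inj (inv_inj sK)) /=.
rewrite [X in _ * X](eq_bigl (fun i : 'I_k => (s i != i) && (i < s i)%N));
  last first.
  move=> i; rewrite sK [i == _]eq_sym -leqNgt leq_eqVlt.
  case: (eqVneq (s i) i) => //= si; rewrite [X in X || _](_ : _ = false) //.
  by apply/negbTE; rewrite eq_sym; exact: si.
by rewrite -big_split; apply: (lnorm_prod sF) => i /andP[/pairG].
Qed.

(** Non-associate irreducibles share no nonzero root and their roots are simple, so only [p i]
    contributes at [r]. *)
Lemma lmu_prod_irreducible (n : nat) (f u : laurent algC) (k : nat)
    (p : 'I_k -> laurent algC) (e : 'I_k -> nat) :
    lunit (Qzeta2 n) u ->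
    (forall i, lirreducible (Qzeta2 n) (p i)) ->
    (forall i j, i != j -> ~ lassociate (Qzeta2 n) (p i) (p j)) ->
    f = u * \prod_(i < k) p i ^+ e i ->
  forall i r, r != 0 -> (0 < lmu r (p i))%N -> lmu r f = e i.
Proof.
move=> u_unit p_irr p_nassoc f_fact i r r0 ri.
have p0 j : p j != 0 by have [] := p_irr j.
have pe0 j : p j ^+ e j != 0 by apply: lexp_neq0.
rewrite f_fact lmuM ?lprod_neq0 // ?(lunit_neq0 u_unit) //.
rewrite (lunit_lmu r0 u_unit) add0n lmu_prod // (bigD1 i) //= big1 ?addn0 =>
  [|j ji].
  rewrite lmuX //; have := irreducible_lmu_le1 (Qzeta2_image n) (p_irr i) r0.
  by case: (lmu r (p i)) ri => [|[|]] //; rewrite muln1.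
rewrite lmuX //; case: (posnP (lmu r (p j))) => [->|rj]; first by rewrite muln0.
have ij : i != j by rewrite eq_sym.
case: (p_nassoc _ _ ij).
exact: (irreducible_associate (Qzeta2_image n) (p_irr i) (p_irr j) r0 ri rj).
Qed.

Lemma lmu_prod_gt0 (n : nat) (f u : laurent algC) (k : nat)
    (p : 'I_k -> laurent algC) (e : 'I_k -> nat) r :
    lunit (Qzeta2 n) u -> (forall i, p i != 0) ->
    f = u * \prod_(i < k) p i ^+ e i ->
  r != 0 -> (0 < lmu r f)%N -> exists i, (0 < lmu r (p i))%N.
Proof.
move=> Uu p0 -> r0; rewrite lmuM ?(lunit_neq0 Uu) //; last first.
  by apply: lprod_neq0 => i; apply: lexp_neq0.
rewrite (lunit_lmu r0 Uu) add0n lmu_prod // => [|i]; last exact: lexp_neq0.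
case: (pickP (fun i => 0 < lmu r (p i))%N) => [i ri _|none]; first by exists i.
rewrite big1 // => i _; rewrite lmuX //.
by have := none i; rewrite lt0n => /negbFE/eqP->; rewrite muln0.
Qed.

Theorem proposition3p10 (n : nat) (n_ge1 : (1 <= n)%N)
    (f u : laurent algC) (k : nat)
    (p : 'I_k -> laurent algC) (e : 'I_k -> nat)
    (f_K : laurent_over (Qzeta2 n) f)
    (u_unit : lunit (Qzeta2 n) u)
    (p_irr : forall i, lirreducible (Qzeta2 n) (p i))
    (p_nassoc : forall i j, i != j -> ~ lassociate (Qzeta2 n) (p i) (p j))
    (e_ge1 : forall i, (1 <= e i)%N)
    (f_fact : f = u * \prod_(i < k) p i ^+ e i) :
  lnorm Qzeta2oo f <->
  forall i : 'I_k,
    [\/ lassociate (Qzeta2 n) (lbar (p i)) (p i) /\ ~~ odd (e i),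
        [/\ lassociate (Qzeta2 n) (lbar (p i)) (p i), odd (e i)
          & lnorm (Qzeta2 (n + dpoly (zeta (2 ^ n)) (p i) + 1)) (p i)]
      | exists j : 'I_k,
          [/\ j != i, lassociate (Qzeta2 n) (lbar (p i)) (p j) & e i = e j]].
Proof.
have p0 i : p i != 0 by have [] := p_irr i.
have sK := Qzeta2_subfieldC n; have soo := Qzeta2oo_subfieldC.
have Koo m x : Qzeta2 m x -> Qzeta2oo x by exists m.
have Kconj x : Qzeta2 n x -> Qzeta2 n x^* by apply: Qzeta2_conj.
split=> [[v [g [Uv Fg fE]]] i|cases].
  have f0 : f != 0.
    rewrite f_fact lmul_eq0 negb_or (lunit_neq0 u_unit).
    by apply: lprod_neq0 => j; apply: lexp_neq0.
  have g0 : g != 0.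
    by apply: contra_neq f0 => g0; rewrite fE g0 mulr0 mul0r.
  have lmu_f r : r != 0 -> lmu r f = (lmu r g + lmu (recip_conj r) g)%N.
    move=> r0; rewrite fE !lmuM ?lmul_eq0 ?negb_or ?g0 ?lbar_eq0
      ?(lunit_neq0 Uv) //.
    by rewrite (lunit_lmu r0 Uv) add0n lmu_bar.
  have expE := lmu_prod_irreducible u_unit p_irr p_nassoc f_fact.
  have [r r0 ri] := irreducible_root (Qzeta2_image n) (p_irr i).
  have rc0 : recip_conj r != 0 by rewrite recip_conj_eq0.
  (* Multiplicities in a norm are invariant under [recip_conj]; so the reflected root is a root of
     some [p j], with [e j = e i]. *)
  have fr : lmu (recip_conj r) f = e i.
    by rewrite lmu_f // recip_conjK addnC -lmu_f // (expE i).
  have [j rj] : exists j, (0 < lmu (recip_conj r) (p j))%N.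
    by apply: (lmu_prod_gt0 u_unit p0 f_fact rc0); rewrite fr.
  have eij : e i = e j by rewrite -fr (expE j).
  have barE : lassociate (Qzeta2 n) (lbar (p i)) (p j).
    apply: (irreducible_associate (Qzeta2_image n) _ (p_irr j) rc0) => //.
      exact: lirreducible_lbar.
    by rewrite lmu_bar // recip_conjK.
  (* A different [j] is case (3); otherwise [p i] is self-conjugate and the parity of [e i]
     separates (1) from (2). *)
  have [ji|ji] := eqVneq j i; last by apply: Or33; exists j.
  rewrite ji in barE; case: (boolP (odd (e i))) => odd_e; last exact: Or31.
  apply: Or32; split=> //; have [N0 gN0] := lover_Qzeta2oo Fg.
  have gN : laurent_over (Qzeta2 (maxn n N0)) g.
    by apply: lover_sub gN0 => x; apply: Qzeta2_mono; rewrite leq_maxr.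
  apply: (norm_factor (N := maxn n N0) (m := (e i)./2) _ (p_irr i) barE gN g0).
    by rewrite n_ge1 leq_maxl.
  move=> r' r'0 r'i; rewrite -lmu_f // (expE i) //.
  by rewrite -[LHS]odd_double_half odd_e.
have assoc_inj i j : lassociate (Qzeta2 n) (p i) (p j) -> i = j.
  by case: (eqVneq i j) => // /p_nassoc.
(* Conversely, every case provides a partner of equal exponent, [i] itself in the first two;
   non-associateness makes the choice unique and [s] an involution. *)
have /fin_all_exists[s sP] i : exists j,
    lassociate (Qzeta2 n) (lbar (p i)) (p j) /\ e i = e j.
  by case: (cases i) => [[]|[]|[j [_ ? ?]]]; [exists i|exists i|exists j].
have barE i : lassociate (Qzeta2 n) (lbar (p i)) (p (s i)) by have [] := sP i.
have s_inv : involutive s.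
  move=> i; apply/esym/assoc_inj; rewrite -[p i]lbarK.
  by apply: (lassociate_trans sK) (barE (s i)); apply: lassociate_lbar.
have assoc_oo g h : lassociate (Qzeta2 n) g h -> lassociate Qzeta2oo g h.
  exact/lassociate_sub/Koo.
have Foo i : laurent_over Qzeta2oo (p i).
  by have [Fp _ _ _] := p_irr i; apply: lover_sub Fp; apply: Koo.
rewrite f_fact; apply: (lnormM soo).
  by apply: (lnorm_unit soo); apply: lunit_sub u_unit; apply: Koo.
(* For [p i] self-conjugate, the even power is an associate of [p i ^+ h] times its own bar. *)
have even_norm i h : s i = i -> lnorm Qzeta2oo (p i ^+ h.*2).
  move=> si; apply: (lnorm_lassociate (g := p i ^+ h));
    first exact: (loverX soo).
  rewrite lbarX -addnn exprD; apply: (lassociateM soo);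
    first exact: lassociate_refl.
  apply: (lassociateX soo); apply: lassociate_sym; apply: assoc_oo.
  by have := barE i; rewrite si.
apply: (lnorm_pairing soo s_inv) => i si.
  case: (cases i) => [[_ ev]|[_ od nm]|[j [ji bj _]]].
  - by rewrite -[e i]odd_double_half (negPf ev); apply: even_norm.
  - rewrite -[e i]odd_double_half od exprS; apply: (lnormM soo);
    last exact: even_norm.
    by apply: lnorm_sub nm; apply: Koo.
  (* Case (3) cannot occur when [s i = i]: both [p j] and [p i] would be associates of
     [lbar (p i)]. *)
  case/eqP: ji; apply: assoc_inj;
    apply: (lassociate_trans sK) (_ : lassociate _ _ (lbar (p i))) _.
    exact: lassociate_sym.
  by have := barE i; rewrite si.
(* A swapped pair has a common exponent, so its product is an associate of [p i ^+ e i] times its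
   bar. *)
have [_ esi] := sP i; rewrite -esi.
apply: (lnorm_lassociate (g := p i ^+ e i)); first exact: (loverX soo).
rewrite lbarX; apply: (lassociateM soo); first exact: lassociate_refl.
by apply: (lassociateX soo); apply: lassociate_sym; apply: assoc_oo.
Qed.
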